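(* Let $E$ be a Drinfeld $\mathbb{F}_q[t]$-module of rank $r$ over $\mathbb{C}_\infty$ with $\phi_t=\theta+\kappa_1\tau+\cdots+\kappa_r\tau^r$, $\kappa_r\neq0$, let $\Lambda_E$ be its period lattice, $\log_E$ its logarithm with radius of convergence $R_E$, and let $\overset{\rightarrow}{\log_E}:\mathbb{C}_\infty\to\mathbb{C}_\infty/\Lambda_E$ be the extended logarithm defined in the context. Let $\xi\in\mathbb{C}_\infty$. Then: (1) if $|\xi|_\infty<R_E$, then $\overset{\rightarrow}{\log_E}(\xi)\equiv\log_E(\xi)\pmod{\Lambda_E}$; (2) $\overset{\rightarrow}{\log_E}$ locally admits analytic lifts: for any $\xi\in\mathbb{C}_\infty$ there is a closed disk $\mathbb{D}\subset\mathbb{C}_\infty$ centered at $\xi$ and a branch $\log_E^\circ$ (an $\mathbb{F}_q$-linear map $\mathbb{C}_\infty\to\mathbb{C}_\infty$ lifting $\overset{\rightarrow}{\log_E}$) such that $\log_E^\circ|_{\mathbb{D}}:\mathbb{D}\to\mathbb{C}_\infty$ is given by a power series.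
   Context: Notation: $q$ a prime power, $k=\mathbb{F}_q(\theta)$, $k_\infty$ its completion at $\infty$ with $|\theta|_\infty=q$, $\mathbb{C}_\infty$ the completion of an algebraic closure of $k_\infty$, $t$ an independent variable, $\tau c=c^q\tau$. $\exp_E$ is the unique $\mathbb{F}_q$-linear entire power series with $\exp_E(X)\equiv X\bmod X^q$ and $\exp_E(a(\theta)X)=\phi_a(\exp_E(X))$; $\log_E$ is its formal inverse; $\Lambda_E=\ker\exp_E$ (a discrete free $\mathbb{F}_q[\theta]$-module of rank $r$). $\mathbb{T}=\{\sum c_it^i: |c_i|_\infty\to0\}$ with Gauss norm $\|\cdot\|$; $\mathbb{T}_\theta=\{\sum c_it^i: |c_i|_\infty q^i\to0\}$; $\mathbb{E}\subset\mathbb{T}$ the power series defining entire functions whose coefficients lie in a finite extension of $k_\infty$. Frobenius twist: $(\sum a_it^i)^{(n)}=\sum a_i^{q^n}t^i$ for $n\in\mathbb{Z}$, entrywise on matrices. $\Phi_E\in\mathrm{Mat}_r(\mathbb{C}_\infty[t])$ has $1$'s on the superdiagonal, zeros elsewhere in the first $r-1$ rows, and last row $\big(\frac{t-\theta}{\kappa_r^{(-r)}},\frac{-\kappa_1^{(-1)}}{\kappa_r^{(-r)}},\dots,\frac{-\kappa_{r-1}^{(-r+1)}}{\kappa_r^{(-r)}}\big)$. Fix a rigid analytic trivialization $\Psi_E\in\mathrm{GL}_r(\mathbb{T}_\theta)\cap\mathrm{Mat}_r(\mathbb{E})$ with $\Psi_E^{(-1)}=\Phi_E\Psi_E$ (one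 exists). It is known (Anderson) that $\Lambda_E=\big(\mathrm{Mat}_{1\times r}(\mathbb{F}_q[t])\Psi_E^{-1}\mathbf{e}_1^{\mathrm{tr}}\big)|_{t=\theta}$, where $\mathbf{e}_1,\dots,\mathbf{e}_r$ is the standard basis of row vectors. Let $\wp_r:\mathrm{Mat}_{1\times r}(\mathbb{T})\to\mathrm{Mat}_{1\times r}(\mathbb{T})$, $\mathbf{Z}\mapsto\mathbf{Z}-\mathbf{Z}^{(1)}$; it is surjective and each fiber $\wp_r^{-1}(\mathbf{h})$ is a coset $\mathbf{h}'+\mathrm{Mat}_{1\times r}(\mathbb{F}_q[t])$ whose entries have the same radius of convergence as those of $\mathbf{h}$. Set $\overset{\rightarrow}{\mathscr{L}_0}(\mathbf{Z}):=\wp_r^{-1}(\mathbf{Z})\in\mathrm{Mat}_{1\times r}(\mathbb{T})/\mathrm{Mat}_{1\times r}(\mathbb{F}_q[t])$. For $\xi\in\mathbb{C}_\infty$, $\overset{\rightarrow}{\log_E}(\xi)$ is defined as $\big(\mathbf{f}\,\Psi_E^{-1}\mathbf{e}_1^{\mathrm{tr}}\big)|_{t=\theta}$ modulo $\Lambda_E$, for any $\mathbf{f}\in\overset{\rightarrow}{\mathscr{L}_0}(\xi\mathbf{e}_1\Psi_E)$ (well defined since the entries converge at $t=\theta$). A branch of $\overset{\rightarrow}{\log_E}$ is an $\mathbb{F}_q$-linear lift $\mathbb{C}_\infty\to\mathbb{C}_\infty$. *)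

(* Defs.v *)
From HB Require Import structures.
From mathcomp Require Import all_boot all_order all_algebra.
From mathcomp Require Import all_classical all_reals all_analysis.
Import Order.TTheory GRing.Theory Num.Theory.
Import numFieldNormedType.Exports.
Set Implicit Arguments.
Unset Strict Implicit.
Unset Printing Implicit Defensive.
Local Open Scope classical_set_scope.
Local Open Scope ring_scope.

(* The normed structures of the libraries require `|x *+ n| = `|x| *+ n, hence
   characteristic zero, so ultrametric absolute values are set up here. *)
Record valuedField (R : realType) := ValuedField {
  vf_field : fieldType;
  vf_abs : vf_field -> R;
  vf_abs_ge0 : forall x, 0 <= vf_abs x;
  vf_abs_eq0 : forall x, vf_abs x = 0 <-> x = 0;
  vf_absM : forall x y, vf_abs (x * y) = vf_abs x * vf_abs y;
  vf_absD : forall x y, vf_abs (x + y) <= Num.max (vf_abs x) (vf_abs y)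
}.

Definition vf_sort (R : realType) (K : valuedField R) : Type := vf_field K.
Coercion vf_sort : valuedField >-> Sortclass.

HB.instance Definition _ (R : realType) (K : valuedField R) :=
  GRing.Field.copy (vf_sort K) (vf_field K).

Definition absv (R : realType) (K : valuedField R) (x : K) : R := vf_abs x.

Section ValuedFieldTopology.
Context (R : realType) (K : valuedField R).
Implicit Types (x y z : K) (e : R).

Lemma absv_ge0 x : 0 <= absv x.
Proof. exact: vf_abs_ge0. Qed.

Lemma absv_eq0 x : (absv x == 0) = (x == 0).
Proof.
apply/eqP/eqP => [|->]; first by move/(vf_abs_eq0 (x : vf_field K)).
exact/(vf_abs_eq0 (0 : vf_field K)).
Qed.

Lemma absv0 : absv (0 : K) = 0.
Proof. by apply/eqP; rewrite absv_eq0. Qed.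

Lemma absvM x y : absv (x * y) = absv x * absv y.
Proof. exact: vf_absM. Qed.

Lemma absvD x y : absv (x + y) <= Num.max (absv x) (absv y).
Proof. exact: vf_absD. Qed.

Lemma absv1 : absv (1 : K) = 1.
Proof.
have n0 : absv (1 : K) != 0 by rewrite absv_eq0 oner_neq0.
by apply: (mulfI n0); rewrite -absvM !mulr1.
Qed.

Lemma absvN x : absv (- x) = absv x.
Proof.
have h : absv (-1 : K) = 1.
  have : absv (-1 : K) ^+ 2 = 1 by rewrite expr2 -absvM mulrNN mulr1 absv1.
  by move/eqP; rewrite sqrp_eq1 ?absv_ge0// => /eqP.
by rewrite -mulN1r absvM h mul1r.
Qed.

Definition vf_ball x e : set K := [set y | absv (x - y) < e].

Lemma vf_ball_center x e : 0 < e -> vf_ball x e x.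
Proof. by rewrite /vf_ball /= subrr absv0. Qed.

Lemma vf_ball_sym x y e : vf_ball x e y -> vf_ball y e x.
Proof. by rewrite /vf_ball /= -absvN opprB. Qed.

Lemma vf_ball_triangle x y z e1 e2 :
  vf_ball x e1 y -> vf_ball y e2 z -> vf_ball x (e1 + e2) z.
Proof.
rewrite /vf_ball /= => h1 h2.
rewrite -(subrKA y) (le_lt_trans (absvD _ _))// gt_max.
have p1 := le_lt_trans (absv_ge0 _) h1; have p2 := le_lt_trans (absv_ge0 _) h2.
by rewrite ltr_wpDr ?(ltW p2)//= ltr_wpDl ?(ltW p1).
Qed.

End ValuedFieldTopology.

HB.instance Definition _ (R : realType) (K : valuedField R) :=
  isPointed.Build (vf_sort K) 0.

HB.instance Definition _ (R : realType) (K : valuedField R) :=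
  hasNbhs.Build (vf_sort K) (nbhs_ (entourage_ (@vf_ball R K))).

HB.instance Definition _ (R : realType) (K : valuedField R) :=
  @Nbhs_isPseudoMetric.Build R (vf_sort K) (entourage_ (@vf_ball R K)) erefl
    (@vf_ball R K) (@vf_ball_center R K) (@vf_ball_sym R K)
    (@vf_ball_triangle R K) erefl.

Section FunctionField.
Context (R : realType) (K : valuedField R) (F : finFieldType).
Context (emb : {rmorphism F -> K}) (th : K).

(* a(theta) for a in F_q[t] *)
Definition at_theta (a : {poly F}) : K := (map_poly emb a).[th].

Definition k_rat : set K :=
  [set x | exists a b : {poly F}, b != 0 /\ x = at_theta a / at_theta b].

(* In a complete K the closure of k is its completion. *)
Definition k_inf : set K := closure k_rat.

Definition k_bar : set K :=
  [set x | exists2 p : {poly K}, p != 0 & (forall i, k_inf p`_i) /\ root p x].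

Definition finite_extension (L : set K) :=
  [/\ GRing.divring_closed [pred x | x \in L], k_inf `<=` L
    & exists2 b : seq K, {in b, forall x, L x} &
        forall x, L x -> exists2 c : seq K, (forall i, k_inf c`_i) &
          x = \sum_(i < size b) c`_i * b`_i].

End FunctionField.

(* [Cinfty R F], for F = F_q, is the type of all models of C_oo: [k_inf] is the
   completion of F_q(theta) for its absolute value with |theta| = q (nonzero
   constants are roots of unity, so they have absolute value 1), [k_bar] is an
   algebraic closure of [k_inf], and the whole field is a completion of
   [k_bar]. *)
Record Cinfty (R : realType) (F : finFieldType) := MkCinfty {
  ci_field :> valuedField R;
  Fq_emb : {rmorphism F -> ci_field};
  theta : ci_field;
  absv_theta : absv theta = #|F|%:R;
  ci_complete : forall G : set_system ci_field,
    ProperFilter G -> cauchy G -> cvg G;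
  ci_bar_closed : forall p : {poly ci_field}, (1 < size p)%N ->
    (forall i, k_bar Fq_emb theta p`_i) ->
    exists2 x, k_bar Fq_emb theta x & root p x;
  ci_bar_dense : dense (k_bar Fq_emb theta)
}.

Record fps (K : Type) := Fps { fps_coef :> nat -> K }.

HB.instance Definition _ (K : Type) := gen_eqMixin (fps K).
HB.instance Definition _ (K : Type) := gen_choiceMixin (fps K).

Section FpsRing.
Context (K : fieldType).
Implicit Types f g h : fps K.

Lemma fpsP f g : f =1 g -> f = g.
Proof. by case: f g => [f] [g] /= fg; congr Fps; exact/funext. Qed.

Definition fps_zero : fps K := Fps (fun=> 0).
Definition fps_opp f := Fps (fun n => - f n).
Definition fps_add f g := Fps (fun n => f n + g n).
Definition fps_one : fps K := Fps (fun n => (n == 0%N)%:R).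
Definition fps_mul f g := Fps (fun n => \sum_(i < n.+1) f i * g (n - i)%N).

Fact fps_addA : associative fps_add.
Proof. by move=> f g h; apply: fpsP => n /=; rewrite addrA. Qed.

Fact fps_addC : commutative fps_add.
Proof. by move=> f g; apply: fpsP => n /=; rewrite addrC. Qed.

Fact fps_add0 : left_id fps_zero fps_add.
Proof. by move=> f; apply: fpsP => n /=; rewrite add0r. Qed.

Fact fps_addN : left_inverse fps_zero fps_opp fps_add.
Proof. by move=> f; apply: fpsP => n /=; rewrite addNr. Qed.

HB.instance Definition _ :=
  GRing.isZmodule.Build (fps K) fps_addA fps_addC fps_add0 fps_addN.

Let trunc n f : {poly K} := \poly_(i < n.+1) f i.

Let truncE n f i : (i <= n)%N -> (trunc n f)`_i = f i.
Proof. by move=> le_in; rewrite coef_poly ltnS le_in. Qed.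

Let mul_trunc m n f g : (n <= m)%N ->
  fps_mul f g n = (trunc m f * trunc m g)`_n.
Proof.
move=> le_nm; rewrite coefM /=; apply: eq_bigr => i _.
by rewrite !truncE// ?(leq_trans (leq_subr _ _))// (leq_trans _ le_nm)// -ltnS.
Qed.

Fact fps_mulC : commutative fps_mul.
Proof.
by move=> f g; apply: fpsP => n; rewrite !(@mul_trunc n)// mulrC.
Qed.

Fact fps_mulA : associative fps_mul.
Proof.
move=> f g h; apply: fpsP => n.
transitivity ((trunc n f * (trunc n g * trunc n h))`_n).
  rewrite coefM; apply: eq_bigr => i _.
  by rewrite -(mul_trunc _ _ (leq_subr i n)) truncE// -ltnS.
rewrite mulrA coefM; apply: eq_bigr => i _.
have le_in : (i <= n)%N by rewrite -ltnS.
by rewrite -(mul_trunc _ _ le_in) truncE ?leq_subr.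
Qed.

Fact fps_mul1 : left_id fps_one fps_mul.
Proof.
move=> f; apply: fpsP => n /=; rewrite big_ord_recl mul1r subn0.
by rewrite big1 ?addr0// => i _; rewrite mul0r.
Qed.

Fact fps_mulDl : left_distributive fps_mul fps_add.
Proof.
move=> f g h; apply: fpsP => n /=; rewrite -big_split.
by apply: eq_bigr => i _; rewrite mulrDl.
Qed.

Fact fps_one_neq0 : fps_one != fps_zero.
Proof.
apply/eqP => /(congr1 (fun f : fps K => f 0%N)) /= /eqP.
by rewrite oner_eq0.
Qed.

HB.instance Definition _ := GRing.Zmodule_isComNzRing.Build (fps K)
  fps_mulA fps_mulC fps_mul1 fps_mulDl fps_one_neq0.

Definition fps_unit : {pred fps K} := [pred f | `[< exists g, g * f = 1 >]].
Definition fps_inv f : fps K :=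
  if f \in fps_unit then xget 0 [set g | g * f = 1] else f.

Fact fps_mulVx : {in fps_unit, left_inverse 1 fps_inv *%R}.
Proof.
move=> f Uf; rewrite /fps_inv Uf; move/asboolP: Uf.
exact: (@xgetPex _ 0 [set g | g * f = 1]).
Qed.

Fact fps_unitPl f g : g * f = 1 -> fps_unit f.
Proof. by move=> gf1; apply/asboolP; exists g. Qed.

Fact fps_inv_out : {in [predC fps_unit], fps_inv =1 id}.
Proof. by move=> f; rewrite inE /= /fps_inv => /negbTE ->. Qed.

HB.instance Definition _ := GRing.ComNzRing_hasMulInverse.Build (fps K)
  fps_mulVx fps_unitPl fps_inv_out.

Definition fps_const (c : K) : fps K := Fps (fun n => c *+ (n == 0%N)).

Definition fps_of_poly (p : {poly K}) : fps K := Fps (fun n => p`_n).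

End FpsRing.

(* x ^ (q ^ n) for n in Z; for n < 0 this is the q^(-n)-th root, which in C_oo
   exists and is unique. *)
Definition frob (K : fieldType) (q : nat) (n : int) (x : K) : K :=
  match n with
  | Posz m => x ^+ (q ^ m)
  | Negz m => xget 0 [set y | y ^+ (q ^ m.+1) = x]
  end.

Definition twist (K : fieldType) (q : nat) (n : int) (f : fps K) : fps K :=
  Fps (fun i => frob q n (f i)).

Section PowerSeriesAnalysis.
Context (R : realType) (F : finFieldType) (C : Cinfty R F).
Local Notation q := #|F|.

Definition fps_eval (f : fps C) (x : C) : C :=
  limn (series (fun i => f i * x ^+ i)).

Definition Tate : set (fps C) :=
  [set f | absv (f i) @[i --> \oo] --> (0 : R)].

Definition Tate_theta : set (fps C) :=
  [set f | absv (f i) * q%:R ^+ i @[i --> \oo] --> (0 : R)].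

Definition entire : set (fps C) :=
  [set f | (forall x : C, cvgn (series (fun i => f i * x ^+ i))) /\
    exists2 L, finite_extension (Fq_emb C) (theta C) L & forall i, L (f i)].

Definition entries_in m n (S : set (fps C)) (A : 'M[fps C]_(m, n)) :=
  forall i j, S (A i j).

Definition GL_Tate_theta r (A : 'M[fps C]_r) :=
  [/\ A \in unitmx, entries_in Tate_theta A & entries_in Tate_theta (invmx A)].

(* A sequence c stands for the F_q-linear power series
   \sum_i c_i X^(q^i), i.e. for \sum_i c_i tau^i; composition of such series is
   the product given by the rule tau c = c^q tau. *)
Definition tau_mul (f g : nat -> C) : nat -> C :=
  fun n => \sum_(i < n.+1) f i * g (n - i)%N ^+ (q ^ i).

Definition tau_const (c : C) : nat -> C := fun n => c *+ (n == 0%N).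

Definition tau_pow (f : nat -> C) (m : nat) : nat -> C :=
  iter m (tau_mul f) (tau_const 1).

Definition tau_terms (f : nat -> C) (x : C) : nat -> C :=
  fun i => f i * x ^+ (q ^ i).

Definition tau_eval (f : nat -> C) (x : C) : C := limn (series (tau_terms f x)).

Definition tau_radius (f : nat -> C) : \bar R :=
  ereal_sup [set rho%:E | rho in
    [set rho : R | 0 <= rho /\
      absv (f i) * rho ^+ (q ^ i) @[i --> \oo] --> (0 : R)]].

End PowerSeriesAnalysis.

(* Only kappa_1, ..., kappa_r are meaningful. *)
Record drinfeldModule (R : realType) (F : finFieldType) (C : Cinfty R F)
    (r : nat) := DrinfeldModule {
  kappa : nat -> C;
  rank_gt0 : (0 < r)%N;
  kappa_rank_neq0 : kappa r != 0
}.

Section DrinfeldModules.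
Context (R : realType) (F : finFieldType) (C : Cinfty R F) (r : nat).
Context (E : drinfeldModule C r).
Local Notation q := #|F|.
Local Notation kap := (kappa E).

Definition phi_t : nat -> C :=
  fun i => if i == 0%N then theta C else if (i <= r)%N then kap i else 0.

Definition phi (a : {poly F}) : nat -> C :=
  fun n => \sum_(j < size a) Fq_emb C a`_j * tau_pow phi_t j n.

Definition is_exp (e : nat -> C) :=
  [/\ e 0%N = 1,
      forall x : C, cvgn (series (tau_terms e x)) &
      forall a : {poly F},
        tau_mul e (tau_const (at_theta (Fq_emb C) (theta C) a))
        = tau_mul (phi a) e].

Definition is_log (e l : nat -> C) :=
  tau_mul l e = tau_const 1 /\ tau_mul e l = tau_const 1.

Definition period_lattice (e : nat -> C) : set C :=
  [set x | tau_eval e x = 0].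

(* The class of x in C_oo / Lambda, as a subset of C_oo. *)
Definition mod_coset (Lambda : set C) (x : C) : set C := [set y | Lambda (y - x)].

Definition Phi : 'M[fps C]_r := \matrix_(i, j) fps_of_poly (
  if i.+1 == r then
    if j == 0%N :> nat then (frob q (- r%:Z) (kap r))^-1 *: ('X - (theta C)%:P)
    else (- frob q (- (j : nat)%:Z) (kap j) / frob q (- r%:Z) (kap r))%:P
  else (j == i.+1 :> nat)%:R).

Definition is_rigid_trivialization (Psi : 'M[fps C]_r) :=
  [/\ GL_Tate_theta Psi, entries_in (@entire R F C) Psi
    & map_mx (twist q (-1)) Psi = Phi *m Psi].

Definition e1 : 'rV[fps C]_r := \row_j (j == 0%N :> nat)%:R.

(* The fibre of Z |-> Z - Z^(1) over Z. *)
Definition vecL0 (Z : 'rV[fps C]_r) : set 'rV[fps C]_r :=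
  [set f | entries_in (@Tate R F C) f /\ f - map_mx (twist q 1) f = Z].

(* The extended logarithm; its value in C_oo / Lambda is a coset, as a set. *)
Definition vec_log (Lambda : set C) (Psi : 'M[fps C]_r) (xi : C) : set C :=
  [set y | exists2 f, vecL0 (fps_const xi *: (e1 *m Psi)) f &
    mod_coset Lambda
      (fps_eval ((f *m invmx Psi *m e1^T) 0 0) (theta C)) y].

Definition is_branch (Lambda : set C) (Psi : 'M[fps C]_r) (L : C -> C) :=
  [/\ forall x y, L (x + y) = L x + L y,
      forall (a : F) x, L (Fq_emb C a * x) = Fq_emb C a * L x &
      forall x, vec_log Lambda Psi x = mod_coset Lambda (L x)].

End DrinfeldModules.

(* Main.v *)
(* Everything follows from one identity: if [f - f^(1) = xi e_1 Psi] then
   [exp_E ((f Psi^-1 e_1^tr)|_{t = theta}) = xi].  Put [g = f Psi^-1]; twisting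
   [Psi^(-1) = Phi Psi] gives [g^(1) = (g - xi e_1) Phi^(1)].  Eliminating the
   entries of [g] other than the first leaves [g_1 = (t - theta) w] with
   [t w = xi + phi_t(w)] coefficientwise, so [phi_t(w_(n+1)) = w_n],
   [phi_t(w_0) = - xi], and [w_n] tends to [0].  Near [0] the exponential is
   injective with inverse [log_E], whence [w_n = - exp_E (y / theta^(n+1))] for a
   fixed [y] with [exp_E y = xi], while the partial sums of [g_1(theta)] are
   [- theta^(n+1) w_n] and tend to [y].

   Hence the extended logarithm of [xi] is the fibre of [exp_E] over [xi], and
   a branch is the same thing as an F_q-linear section of [exp_E].  Extending
   [log_E] from a small disk around [0] to such a section (Zorn) yields a branch
   [L] with [L x = L xi + log_E (x - xi)] for [x] close to [xi]. *)

Require Import Defs.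
From HB Require Import structures.
From mathcomp Require Import all_boot all_order all_algebra all_field.
From mathcomp Require Import all_classical all_reals all_analysis.
Import Order.TTheory GRing.Theory Num.Theory.
Import numFieldNormedType.Exports.
Set Implicit Arguments.
Unset Strict Implicit.
Unset Printing Implicit Defensive.
Local Open Scope classical_set_scope.
Local Open Scope ring_scope.

(** * Convergence in an ultrametric field *)

Section ValuedField.
Context (R : realType) (K : valuedField R).
Implicit Types (x y z l : K) (u v : nat -> K).

Lemma absvB x y : absv (x - y) <= Num.max (absv x) (absv y).
Proof. by rewrite -(absvN y) absvD. Qed.

Lemma absvX x n : absv (x ^+ n) = absv x ^+ n.
Proof. by elim: n => [|n IHn]; rewrite ?expr0 ?absv1// !exprS absvM IHn. Qed.

Lemma absv_sum_le (I : Type) (s : seq I) (P : pred I) (f : I -> K) (B : R) :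
  0 <= B -> (forall i, P i -> absv (f i) <= B) ->
  absv (\sum_(i <- s | P i) f i) <= B.
Proof.
move=> B0 fB; apply: (big_ind (fun x => absv x <= B)) => //; first by rewrite absv0.
by move=> x y xB yB; rewrite (le_trans (absvD _ _))// ge_max xB.
Qed.

Lemma cvg_absvP u l : u @ \oo --> l <->
  forall e : R, 0 < e -> exists N, forall n, (N <= n)%N -> absv (u n - l) < e.
Proof.
split=> [ul e e0|ul].
  have /cvg_ballP/(_ e e0) [N _ Nu] := ul.
  by exists N => n Nn; have := Nu n Nn; rewrite /ball /= /vf_ball /= -absvN opprB.
apply/cvg_ballP => e /ul [N Nu]; exists N => // n /Nu.
by rewrite /ball /= /vf_ball /= -absvN opprB.
Qed.

Lemma absv_cvg0P (u : nat -> K) (c : nat -> R) :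
  absv (u n) * c n @[n --> \oo] --> (0 : R) <->
  forall e : R, 0 < e -> exists N, forall n, (N <= n)%N -> absv (u n) * `|c n| < e.
Proof.
have E n : `|0 - absv (u n) * c n| = absv (u n) * `|c n|.
  by rewrite sub0r normrN normrM ger0_norm ?absv_ge0.
split=> [/cvgrPdist_lt h e e0|h].
  by have [N _ Nu] := h e e0; exists N => n /Nu; rewrite /= E.
apply/cvgrPdist_lt => e /h [N Nu]; exists N => // n /Nu.
by rewrite /= E.
Qed.

Lemma valued_hausdorff : hausdorff_space K.
Proof.
rewrite ball_hausdorff => x y xy.
have d0 : 0 < absv (x - y) by rewrite lt_def absv_ge0 andbT absv_eq0 subr_eq0.
exists (PosNum d0, PosNum d0); apply/eqP/seteqP; split => // z [] /=.
rewrite /ball /= /vf_ball /= => xz yz.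
suff : absv (x - y) < absv (x - y) by rewrite ltxx.
rewrite -{1}(subrKA z) (le_lt_trans (absvD _ _))// gt_max xz.
by rewrite -absvN opprB.
Qed.

Lemma lim_valued u l : u @ \oo --> l -> limn u = l.
Proof. by apply: cvg_lim; apply: valued_hausdorff. Qed.

Lemma cvg_valued_unique {u l l'} : u @ \oo --> l -> u @ \oo --> l' -> l = l'.
Proof. by move=> /lim_valued <- /lim_valued <-. Qed.

Lemma cvgD_valued {u v l l'} : u @ \oo --> l -> v @ \oo --> l' ->
  (fun n => u n + v n) @ \oo --> l + l'.
Proof.
move=> /cvg_absvP ul /cvg_absvP vl; apply/cvg_absvP => e e0.
have [N Nu] := ul e e0; have [M Mv] := vl e e0.
exists (maxn N M) => n; rewrite geq_max => /andP[/Nu ? /Mv ?].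
by rewrite opprD addrACA (le_lt_trans (absvD _ _))// gt_max; apply/andP.
Qed.

Lemma cvgZ_valued {c u l} : u @ \oo --> l -> (fun n => c * u n) @ \oo --> c * l.
Proof.
have [->|c0] := eqVneq c 0.
  move=> _; rewrite mul0r; apply/cvg_absvP => e e0.
  by exists 0%N => n _; rewrite mul0r subrr absv0.
have c0' : 0 < absv c by rewrite lt_def absv_ge0 andbT absv_eq0.
move=> /cvg_absvP ul; apply/cvg_absvP => e e0.
have [N Nu] := ul (e / absv c) (divr_gt0 e0 c0').
by exists N => n /Nu; rewrite -mulrBr absvM ltr_pdivlMr// mulrC.
Qed.

Lemma cvg_valued_le u l (B : R) :
  (forall n, absv (u n) <= B) -> u @ \oo --> l -> absv l <= B.
Proof.
move=> uB /cvg_absvP ul; rewrite leNgt; apply/negP => Bl.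
have l0 : 0 < absv l by apply: le_lt_trans Bl; apply: le_trans (uB 0%N); apply: absv_ge0.
have [N /(_ N (leqnn N)) ulN] := ul _ l0.
suff : absv l < absv l by rewrite ltxx.
rewrite -{1}(opprK l) -(addKr (u N) (- l)) addrC absvN.
rewrite (le_lt_trans (absvD _ _))// gt_max ulN absvN.
exact: le_lt_trans (uB N) Bl.
Qed.

Definition null_seq u :=
  forall e : R, 0 < e -> exists N, forall n, (N <= n)%N -> absv (u n) < e.

Lemma null_seqP u : null_seq u <-> absv (u n) @[n --> \oo] --> (0 : R).
Proof.
have -> : (fun n => absv (u n)) = (fun n => absv (u n) * 1).
  by apply/funext => n; rewrite mulr1.
rewrite absv_cvg0P.
by split=> h e /h [N Nu]; exists N => n /Nu; rewrite normr1 mulr1.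
Qed.

Lemma null_seq_le u v : (forall n, absv (u n) <= absv (v n)) ->
  null_seq v -> null_seq u.
Proof. by move=> uv h e /h [N Nv]; exists N => n /Nv; apply: le_lt_trans. Qed.

Lemma null_seq_bounded u : null_seq u -> exists2 B, 0 < B & forall n, absv (u n) <= B.
Proof.
move=> /(_ 1 ltr01) [N Nu].
exists (1 + \sum_(i < N) absv (u i)).
  by rewrite ltr_pwDl// sumr_ge0// => i _; apply: absv_ge0.
have S0 : 0 <= \sum_(i < N) absv (u i) by apply: sumr_ge0 => i _; apply: absv_ge0.
move=> n; have [/Nu/ltW un|nN] := leqP N n; first by rewrite (le_trans un)// lerDl.
rewrite (bigD1 (Ordinal nN)) //= addrCA lerDl addr_ge0// sumr_ge0// => i _.
exact: absv_ge0.
Qed.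

Lemma null_seqD {u v} : null_seq u -> null_seq v -> null_seq (fun n => u n + v n).
Proof.
move=> hu hv e e0; have [N Nu] := hu e e0; have [M Mv] := hv e e0.
exists (maxn N M) => n; rewrite geq_max => /andP[/Nu ? /Mv ?].
by rewrite (le_lt_trans (absvD _ _))// gt_max; apply/andP.
Qed.

Lemma null_seqZ {c u} : null_seq u -> null_seq (fun n => c * u n).
Proof.
move=> hu.
have : u @ \oo --> (0 : K).
  by apply/cvg_absvP => e /hu [N Nu]; exists N => n; rewrite subr0; apply: Nu.
move=> /(@cvgZ_valued c)/cvg_absvP; rewrite mulr0 => h e /h [N Nu].
by exists N => n; rewrite -[c * _]subr0; apply: Nu.
Qed.

Lemma cvg_null_seq u l : u @ \oo --> l <-> null_seq (fun n => u n - l).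
Proof. exact: cvg_absvP. Qed.

Lemma cvg_series_null u : cvgn (series u) -> null_seq u.
Proof.
move=> /cvg_ex [l /cvg_absvP ul] e e0; have [N Nu] := ul e e0.
exists N => n Nn.
have -> : u n = (series u n.+1 - l) - (series u n - l).
  by rewrite opprB addrA subrK seriesSB.
rewrite (le_lt_trans (absvB _ _))// gt_max !Nu// ltnW//.
Qed.

(** Only the finitely many rows [i < N] escape the uniform bound, and each of them is small from a
    threshold of its own. This controls both Cauchy products and the composition of tau-series. *)
Lemma antidiagonal_small (b : nat -> nat -> R) :
  (forall e, 0 < e -> exists N, forall i m, (N <= i)%N -> b i m < e) ->
  (forall i e, 0 < e -> exists M, forall m, (M <= m)%N -> b i m < e) ->
  forall e, 0 < e -> exists N, forall n i, (N <= n)%N -> (i <= n)%N -> b i (n - i)%N < e.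
Proof.
move=> h1 h2 e e0; have [N Nb] := h1 e e0.
have [f fb] := choice (fun i => h2 i e e0).
exists (N + \max_(i < N) f i)%N => n i le_n le_i.
have [/Nb//|lt_i] := leqP N i.
apply: fb; rewrite leq_subRL// (leq_trans _ le_n)// leq_add ?(ltnW lt_i)//.
exact: (leq_bigmax (Ordinal lt_i)).
Qed.

Lemma convolution_null u v : null_seq u -> null_seq v ->
  null_seq (fun n => \sum_(i < n.+1) u i * v (n - i)%N).
Proof.
move=> hu hv e e0.
have [A A0 uA] := null_seq_bounded hu; have [B B0 vB] := null_seq_bounded hv.
(* [absv_sum_le] yields a weak inequality, hence the bound [e / 2] on each term. *)
have e2 : 0 < e / 2 by rewrite divr_gt0.
have [||N Nb] := @antidiagonal_small (fun i m => absv (u i * v m)) _ _ (e / 2) e2.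
- move=> d d0; have [N Nu] := hu (d / B) (divr_gt0 d0 B0).
  exists N => i m /Nu /=; rewrite ltr_pdivlMr// absvM => ub.
  by rewrite (le_lt_trans _ ub)// ler_wpM2l// absv_ge0.
- move=> i d d0; have [N Nv] := hv (d / A) (divr_gt0 d0 A0).
  exists N => m /Nv /=; rewrite ltr_pdivlMr// => vb.
  by rewrite absvM mulrC (le_lt_trans _ vb)// ler_wpM2l// absv_ge0.
exists N => n Nn; apply: le_lt_trans (_ : e / 2 < e); last first.
  by rewrite ltr_pdivrMr// ltr_pMr// ltr1n.
apply: absv_sum_le => [|i _]; first exact: ltW.
by apply/ltW/Nb => //; rewrite -ltnS.
Qed.

End ValuedField.

(** * Frobenius powers and null series in [C] *)

Section Cinfty.
Context (R : realType) (F : finFieldType) (C : Cinfty R F).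
Local Notation q := #|F|.
Implicit Types (x y z c : C) (u v : nat -> C).

Lemma cardF_gt1 : (1 < q)%N.
Proof. exact: finRing_gt1. Qed.

Lemma cardF_gt0 : (0 < q)%N.
Proof. exact: ltnW cardF_gt1. Qed.

Lemma cardX_gt0 i : (0 < q ^ i)%N.
Proof. by rewrite expn_gt0 cardF_gt0. Qed.

Lemma cardX_gt1 i : (0 < i)%N -> (1 < q ^ i)%N.
Proof. by move=> i0; rewrite -(exp1n i) ltn_exp2r// cardF_gt1. Qed.

Lemma ltn_cardX i : (i < q ^ i)%N.
Proof. exact: ltn_expl cardF_gt1. Qed.

Lemma pchar_pnat_cardX i : [pchar C].-nat (q ^ i)%N.
Proof.
have [p p_pr pF] := finPcharP F.
have pC : p \in [pchar C].
  rewrite inE p_pr /= -(rmorph_nat (Fq_emb C)); apply/eqP.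
  by rewrite (pcharf0 pF) rmorph0.
rewrite (eq_pnat _ (pcharf_eq pC)) pnatX; apply/orP; left.
by rewrite (card_pprimeChar pF) pnatX pnat_id.
Qed.

Lemma exprD_cardX i x y : (x + y) ^+ (q ^ i) = x ^+ (q ^ i) + y ^+ (q ^ i).
Proof. exact/exprDn_pchar/pchar_pnat_cardX. Qed.

Lemma expr0_cardX i : (0 : C) ^+ (q ^ i) = 0.
Proof. by rewrite expr0n -leqn0 leqNgt cardX_gt0. Qed.

Lemma exprN_cardX i x : (- x) ^+ (q ^ i) = - x ^+ (q ^ i).
Proof. by apply/eqP; rewrite -addr_eq0 -exprD_cardX addNr expr0_cardX. Qed.

Lemma exprB_cardX i x y : (x - y) ^+ (q ^ i) = x ^+ (q ^ i) - y ^+ (q ^ i).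
Proof. by rewrite exprD_cardX exprN_cardX. Qed.

Lemma expr_sum_cardX i (I : Type) (s : seq I) (P : pred I) (f : I -> C) :
  (\sum_(j <- s | P j) f j) ^+ (q ^ i) = \sum_(j <- s | P j) f j ^+ (q ^ i).
Proof.
by apply: (big_morph (fun x => x ^+ (q ^ i)) (@exprD_cardX i) (expr0_cardX i)).
Qed.

Lemma expr_cardX_inj i : injective (fun x => x ^+ (q ^ i)).
Proof.
move=> x y /= /eqP; rewrite -subr_eq0 -exprB_cardX expf_eq0 cardX_gt0 /= subr_eq0.
by move/eqP.
Qed.

Lemma exprX_cardX i j x : x ^+ (q ^ (i + j)) = (x ^+ (q ^ i)) ^+ (q ^ j).
Proof. by rewrite -exprM -expnD. Qed.

Lemma Fq_emb_cardX (a : F) i : Fq_emb C a ^+ (q ^ i) = Fq_emb C a.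
Proof.
elim: i => [|i IHi]; first by rewrite expn0 expr1.
by rewrite -addn1 exprX_cardX IHi expn1 -rmorphXn /= expf_card.
Qed.

(** Since [a ^+ q = a], and a [q]-th power would strictly enlarge an absolute value above 1. *)
Lemma absv_Fq_le1 (a : F) : absv (Fq_emb C a) <= 1.
Proof.
rewrite leNgt; apply/negP => a1.
have := congr1 (@absv R C) (Fq_emb_cardX a 1); rewrite expn1 absvX => /eqP.
by rewrite gt_eqF// ltr_eXnr// cardF_gt1.
Qed.

Lemma cvg_expr_cardX i u x : u @ \oo --> x ->
  (fun n => u n ^+ (q ^ i)) @ \oo --> x ^+ (q ^ i).
Proof.
move=> /cvg_absvP ux; apply/cvg_absvP => e e0.
have d0 : 0 < Num.min e 1 by rewrite lt_min e0 ltr01.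
have [N Nu] := ux _ d0; exists N => n /Nu; rewrite lt_min => /andP[ue u1].
rewrite -exprB_cardX absvX; apply: le_lt_trans ue.
by rewrite -[leRHS]expr1 ler_wiXn2l ?absv_ge0 ?cardX_gt0 ?ltW.
Qed.

(** The ultrametric inequality bounds any stretch of the series by its largest term, so null terms
    already make the partial sums Cauchy. *)
Lemma cvg_null_series u : null_seq u -> cvgn (series u).
Proof.
move=> hu; apply: ci_complete; apply/cauchy_ballP => e e0.
have [N Nu] := hu e e0.
have tail n : (N <= n)%N -> absv (series u n - series u N) < e.
  move=> Nn; rewrite sub_series_geq//.
  rewrite big_nat; elim/big_ind: _ => [|x y xe ye|i /andP[/Nu//]].
  - by rewrite absv0.
  - by rewrite (le_lt_trans (absvD _ _))// gt_max xe.
exists ([set y | exists2 n, (N <= n)%N & y = series u n],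
        [set y | exists2 n, (N <= n)%N & y = series u n]) => /=.
  by split; exists N => // n Nn; exists n.
move=> [x y] /= [[m Nm ->] [n Nn ->]].
rewrite /ball /= /vf_ball /= -(subrKA (series u N)).
rewrite (le_lt_trans (absvD _ _))// gt_max tail//=.
by rewrite -absvN opprB tail.
Qed.

End Cinfty.

(** * [q]-th roots and Artin-Schreier equations in [C] *)

Section AlgebraicEquations.
Context (R : realType) (F : finFieldType) (C : Cinfty R F).
Local Notation q := #|F|.
Local Notation kbar := (k_bar (Fq_emb C) (theta C)).
Implicit Types (x y z c : C).

Lemma k_inf_Fq (a : F) : k_inf (Fq_emb C) (theta C) (Fq_emb C a).
Proof.
apply: subset_closure; exists a%:P, 1; split; first exact: oner_neq0.
by rewrite /at_theta rmorph1 map_polyC !hornerC divr1.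
Qed.

(** Supplies the coefficients 0, 1 and -1 of the polynomials to be solved in [k_bar]. *)
Lemma k_bar_Fq (a : F) : kbar (Fq_emb C a).
Proof.
exists ('X - (Fq_emb C a)%:P); first by rewrite polyXsubC_eq0.
split; last by rewrite root_XsubC.
move=> i; rewrite coefB coefX coefC -(rmorph_nat (Fq_emb C)).
case: i => [|i] /=.
  by rewrite -rmorphB; apply: k_inf_Fq.
by rewrite subr0; apply: k_inf_Fq.
Qed.

Lemma k_bar_near x (e : R) : 0 < e -> exists2 y, kbar y & absv (x - y) < e.
Proof.
move=> e0; have [] := @ci_bar_dense R F C (interior (ball x e)).
- by exists x; apply: nbhsx_ballx.
- exact: open_interior.
by move=> y [/interior_subset xy ky]; exists y.
Qed.

(** Solving [X ^ (q ^ i) + c = 0] for [c] in [k_bar] near [- x] gives approximate roots. By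
    additivity of Frobenius, [|u - v| ^ (q ^ i)] is the distance of the powers, so these roots
    converge, and their limit is a root of [x]. *)
Lemma cinfty_perfect i x : exists y, y ^+ (q ^ i) = x.
Proof.
have near_root n : exists y, absv (x - y ^+ (q ^ i)) < n.+1%:R^-1.
  have [c kc cx] := k_bar_near (- x) (e := n.+1%:R^-1) ltac:(by rewrite invr_gt0).
  have sz : size ('X^(q ^ i) + c%:P) = (q ^ i).+1.
    by rewrite size_polyDl size_polyXn// ltnS (leq_trans (size_polyC_leq1 _))// cardX_gt0.
  have [|j|y ky] := @ci_bar_closed R F C ('X^(q ^ i) + c%:P).
  - by rewrite sz ltnS cardX_gt0.
  - rewrite coefD coefXn coefC; case: j => [|j] /=; last first.
      by rewrite addr0 -(rmorph_nat (Fq_emb C)); apply: k_bar_Fq.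
    by rewrite eq_sym -leqn0 leqNgt cardX_gt0 add0r.
  move=> /eqP; rewrite hornerD hornerXn hornerC => /eqP.
  rewrite addr_eq0 => /eqP yc; exists y.
  by rewrite yc opprK -absvN opprD.
have [u ux] := choice near_root.
have uN : (fun n => u n ^+ (q ^ i)) @ \oo --> x.
  apply/cvg_absvP => e e0; exists (Num.truncn e^-1) => n Nn.
  rewrite -absvN opprB (lt_le_trans (ux n))// invf_ple ?posrE//.
  by rewrite ltW// (lt_le_trans (truncnS_gt _))// ler_nat.
have /cvg_ex [y uy] : cvgn u.
  have : cvgn (series (fun n => u n.+1 - u n)).
    apply: cvg_null_series => e e0.
    have /cvg_absvP/(_ (e ^+ (q ^ i)) (exprn_gt0 _ e0)) [N Nu] := uN.
    exists N => n Nn; rewrite -(@ltr_pXn2r _ (q ^ i)) ?nnegrE ?absv_ge0 ?ltW//; last first.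
      exact: cardX_gt0.
    rewrite -absvX exprB_cardX -(subrKA x) (le_lt_trans (absvD _ _))// gt_max.
    by rewrite Nu ?(leqW Nn)// -absvN opprB Nu.
  move=> /cvg_ex [y uy]; apply/cvg_ex; exists (y + u 0%N).
  apply/cvg_absvP => e /((cvg_absvP _ _).1 uy) [N Nu]; exists N => n /Nu.
  by rewrite (_ : series _ n = u n - u 0%N) ?[y + _]addrC ?opprD ?addrA//
     seriesEnat /= telescope_sumr.
by exists y; apply: cvg_valued_unique (cvg_expr_cardX uy) uN.
Qed.

(** For [n > 0] the existence of roots rules out the default value of [xget]. *)
Lemma frobNK n x : frob q (- n%:Z) x ^+ (q ^ n) = x.
Proof.
case: n => [|n] /=; first by rewrite expr1 expn0 expr1.
exact: (@xgetPex _ 0 [set y | y ^+ (q ^ n.+1) = x] (cinfty_perfect _ _)).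
Qed.

(** The solution is [\sum_n c ^ (q ^ n)], convergent as [|c| < 1]; raising it to the power [q] drops
    its first term. *)
Lemma artin_schreier_small c : absv c < 1 ->
  exists2 z, z - z ^+ q = c & absv z <= absv c.
Proof.
move=> c1; pose u n := c ^+ (q ^ n).
have uc n : absv (u n) <= absv c.
  by rewrite absvX -[leRHS]expr1 ler_wiXn2l ?absv_ge0 ?cardX_gt0 ?ltW.
have hu : null_seq u.
  move=> e e0.
  have /cvgrPdist_lt/(_ e e0) [N _ Ne] : (absv c) ^+ n @[n --> \oo] --> (0 : R).
    by apply: cvg_expr; rewrite ger0_norm ?absv_ge0.
  exists N => n /Ne /=; rewrite sub0r normrN normrX ger0_norm ?absv_ge0//.
  apply: le_lt_trans; rewrite absvX ler_wiXn2l ?absv_ge0 ?ltW//.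
  exact/ltnW/ltn_cardX.
have /cvg_ex [z uz] := cvg_null_series hu.
exists z; last first.
  apply: cvg_valued_le uz => n; rewrite seriesEnat /=.
  by apply: absv_sum_le; rewrite ?absv_ge0.
have uq : (fun n => series u n ^+ q) @ \oo --> z ^+ q.
  by have := cvg_expr_cardX (i := 1) uz; rewrite expn1.
have step n : series u n - series u n ^+ q = c - u n.
  rewrite -[q]expn1 seriesEnat /= expr_sum_cardX -sumrB.
  rewrite (eq_bigr (fun i => - (u i.+1 - u i))) => [|i _].
    by rewrite sumrN telescope_sumr// opprB /u expn0 expr1.
  by rewrite -exprX_cardX addn1 opprB.
have := cvgD_valued uz (cvgZ_valued (c := -1) uq).
rewrite mulN1r => /cvg_valued_unique; apply.
apply/cvg_null_seq => e /hu [N Nu]; exists N => n /Nu.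
by rewrite mulN1r step addrC addKr absvN.
Qed.

(** Split [c] as [(c - d) + d] with [d] in [k_bar] and [|c - d| < 1]: the series solves the first
    part, an algebraic equation the second. The guarded bound lets one choice function serve all
    coefficients of a power series. *)
Lemma artin_schreier c :
  exists z, z - z ^+ q = c /\ (absv c < 1 -> absv z <= absv c).
Proof.
have [/artin_schreier_small [z]|_] := ltP (absv c) 1; first by exists z.
suff [z zc] : exists z, z - z ^+ q = c by exists z; split.
have [d kd dc] := k_bar_near c ltr01.
have [z1 z1c _] := artin_schreier_small dc.
have sz : size ('X^q - 'X + d%:P : {poly C}) = q.+1.
  have sX : size ('X^q - 'X : {poly C}) = q.+1.
    by rewrite size_polyDl size_polyXn// size_polyN size_polyX ltnS cardF_gt1.
  rewrite size_polyDl ?sX// (leq_ltn_trans (size_polyC_leq1 _))// ltnS.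
  by rewrite cardF_gt0.
have [|j|z2 kz2] := @ci_bar_closed R F C ('X^q - 'X + d%:P).
- by rewrite sz ltnS cardF_gt0.
- rewrite coefD coefB coefXn coefX coefC; case: j => [|j] /=; last first.
    by rewrite addr0 -!(rmorph_nat (Fq_emb C)) -rmorphB; apply: k_bar_Fq.
  by rewrite eq_sym -leqn0 leqNgt cardF_gt0 subrr add0r.
rewrite /root !hornerE addr_eq0 => /eqP /(congr1 -%R); rewrite opprB opprK => z2d.
exists (z1 + z2); rewrite -{1}[q]expn1 exprD_cardX expn1 opprD addrACA z1c z2d.
by rewrite subrK.
Qed.

(** All but finitely many coefficients are below 1 in absolute value, and there the solution is no
    larger than the coefficient. *)
Lemma artin_schreier_null (h : nat -> C) : null_seq h ->
  exists2 f, null_seq f & forall n, f n - f n ^+ q = h n.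
Proof.
move=> hh; have [s sP] := choice artin_schreier.
exists (s \o h) => [e e0|n /=]; last by have [] := sP (h n).
have d0 : 0 < Num.min e 1 by rewrite lt_min e0 ltr01.
have [N Nh] := hh _ d0; exists N => n /Nh; rewrite lt_min => /andP[he h1].
by have [_ /(_ h1) sh] := sP (h n); apply: le_lt_trans sh he.
Qed.

End AlgebraicEquations.

(** * Evaluation and composition of [F_q]-linear series *)

Section TauSeries.
Context (R : realType) (F : finFieldType) (C : Cinfty R F).
Local Notation q := #|F|.
Implicit Types (x y z c : C) (f g : nat -> C).

Lemma absv_tau_terms f x i :
  absv (tau_terms f x i) = absv (f i) * absv x ^+ (q ^ i).
Proof. by rewrite absvM absvX. Qed.

Lemma tau_eval_cvg f x : null_seq (tau_terms f x) ->
  series (tau_terms f x) @ \oo --> tau_eval f x.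
Proof. by move=> /cvg_null_series/cvg_ex[l fl]; rewrite /tau_eval (lim_valued fl). Qed.

Lemma tau_termsD f x y i :
  tau_terms f (x + y) i = tau_terms f x i + tau_terms f y i.
Proof. by rewrite /tau_terms exprD_cardX mulrDr. Qed.

Lemma tau_termsZ f a x i :
  tau_terms f (Fq_emb C a * x) i = Fq_emb C a * tau_terms f x i.
Proof. by rewrite /tau_terms exprMn Fq_emb_cardX mulrCA. Qed.

Lemma tau_evalD f x y : null_seq (tau_terms f x) -> null_seq (tau_terms f y) ->
  tau_eval f (x + y) = tau_eval f x + tau_eval f y.
Proof.
move=> /tau_eval_cvg fx /tau_eval_cvg fy; apply: lim_valued.
suff -> : series (tau_terms f (x + y)) =
    fun n => series (tau_terms f x) n + series (tau_terms f y) n.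
  exact: cvgD_valued.
apply/funext => n.
by rewrite seriesEnat /= -big_split; apply: eq_bigr => i _; rewrite tau_termsD.
Qed.

Lemma tau_evalZ f a x : null_seq (tau_terms f x) ->
  tau_eval f (Fq_emb C a * x) = Fq_emb C a * tau_eval f x.
Proof.
move=> /tau_eval_cvg fx; apply: lim_valued.
suff -> : series (tau_terms f (Fq_emb C a * x)) =
    fun n => Fq_emb C a * series (tau_terms f x) n.
  exact: cvgZ_valued.
apply/funext => n.
by rewrite seriesEnat /= mulr_sumr; apply: eq_bigr => i _; rewrite tau_termsZ.
Qed.

Lemma tau_eval_fin f x N : (forall i, (N <= i)%N -> f i = 0) ->
  tau_eval f x = \sum_(i < N) f i * x ^+ (q ^ i).
Proof.
move=> f0; apply: lim_valued; apply/cvg_absvP => e e0; exists N => n Nn.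
rewrite seriesEnat /= (big_cat_nat _ Nn)//= big_mkord addrAC subrr add0r.
rewrite big_nat big1 ?absv0// => i /andP[/f0 fi0 _].
by rewrite /tau_terms fi0 mul0r.
Qed.

(** The radius [B] is a real number rather than the absolute value of a point, so that a bound on a
    whole sequence of arguments can be inserted. *)
Definition tau_entire f := forall B : R, 0 <= B ->
  forall e : R, 0 < e -> exists N, forall i, (N <= i)%N ->
    absv (f i) * B ^+ (q ^ i) < e.

Lemma tau_entire_null f x : tau_entire f -> null_seq (tau_terms f x).
Proof.
move=> fE e e0; have [N Nf] := fE (absv x) (absv_ge0 x) e e0.
by exists N => i /Nf; rewrite absv_tau_terms.
Qed.

Lemma tau_fin_entire f N : (forall i, (N <= i)%N -> f i = 0) -> tau_entire f.
Proof. by move=> f0 B _ e e0; exists N => i /f0 ->; rewrite absv0 mul0r. Qed.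

(** As [|theta| = q > 1], every real radius lies below some [|theta ^ m|]. *)
Lemma cvg_tau_entire f : (forall x, cvgn (series (tau_terms f x))) -> tau_entire f.
Proof.
move=> fc B B0 e e0; pose m := Num.truncn B.
have [N Nf] := cvg_series_null (fc (theta C ^+ m.+1)) e0.
exists N => i /Nf; apply: le_lt_trans; rewrite absv_tau_terms.
rewrite ler_wpM2l ?absv_ge0// lerXn2r ?nnegrE ?absv_ge0// absvX absv_theta.
apply: ltW; apply: lt_le_trans (truncnS_gt _) _.
by rewrite -natrX ler_nat ltnW// ltn_expl// cardF_gt1.
Qed.

(** Frobenius powers are additive, so expanding the inner partial sums of length [N - i] gives
    exactly the terms of tau-degree below [N]. *)
Lemma series_tau_mul f g x N :
  series (tau_terms (tau_mul f g) x) N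
  = \sum_(i < N) f i * series (tau_terms g x) (N - i)%N ^+ (q ^ i).
Proof.
elim: N => [|N IHN]; first by rewrite seriesEnat /= big_geq// big_ord0.
have serS h m : series h m.+1 = series h m + h m :> C.
  by rewrite seriesEnat /= big_nat_recr.
rewrite serS IHN.
transitivity (\sum_(i < N.+1) f i * series (tau_terms g x) (N - i)%N ^+ (q ^ i)
  + \sum_(i < N.+1) f i * tau_terms g x (N - i)%N ^+ (q ^ i)).
  congr (_ + _).
    rewrite big_ord_recr /= subnn seriesEnat /= big_geq// expr0_cardX mulr0.
    by rewrite addr0.
  rewrite /tau_terms /tau_mul mulr_suml; apply: eq_bigr => i _.
  by rewrite exprMn -exprX_cardX subnK ?mulrA// -ltnS.
rewrite -big_split; apply: eq_bigr => i _ /=.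
by rewrite subSn ?serS ?exprD_cardX ?mulrDr// -ltnS.
Qed.

(** With [S] the partial sums of [g], those of the composite differ from those of [f] at [s] by
    [\sum_(i < n) f i (S (n - i) - s) ^ (q ^ i)]. These terms are small because [f] is entire for
    large [i], and because [S] tends to [s] for fixed [i]. *)
Lemma tau_eval_comp f g x : tau_entire f -> null_seq (tau_terms g x) ->
  tau_eval (tau_mul f g) x = tau_eval f (tau_eval g x).
Proof.
move=> fE gx; apply: lim_valued; set s := tau_eval g x.
have gs : null_seq (fun m => series (tau_terms g x) m - s).
  exact/cvg_null_seq/tau_eval_cvg.
have [B B0 gB] := null_seq_bounded gs.
have /cvg_absvP fs := tau_eval_cvg (tau_entire_null s fE).
apply/cvg_absvP => e e0.
have e2 : 0 < e / 2 by rewrite divr_gt0.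
have [||N Nb] := @antidiagonal_small R (fun i m => absv (f i) *
  absv (series (tau_terms g x) m - s) ^+ (q ^ i)) _ _ (e / 2) e2.
- move=> d d0; have [N Nf] := fE B (ltW B0) d d0; exists N => i m /Nf.
  apply: le_lt_trans; rewrite ler_wpM2l ?absv_ge0// lerXn2r// ?nnegrE ?absv_ge0//.
  exact: ltW.
- move=> i d d0.
  have hu : null_seq (fun m => f i * (series (tau_terms g x) m - s) ^+ (q ^ i)).
    apply: null_seqZ; apply: null_seq_le (_ : null_seq (fun m =>
      (series (tau_terms g x) m) ^+ (q ^ i) - s ^+ (q ^ i))) => [m|].
      by rewrite exprB_cardX.
    exact/cvg_null_seq/cvg_expr_cardX/tau_eval_cvg.
  by have [M Mu] := hu d d0; exists M => m /Mu; rewrite absvM absvX.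
have [M Mf] := fs e e0.
exists (maxn N M) => n; rewrite geq_max => /andP[Nn /Mf Mn].
rewrite series_tau_mul -(subrKA (series (tau_terms f s) n)).
rewrite (le_lt_trans (absvD _ _))// gt_max Mn andbT.
have -> : series (tau_terms f s) n = \sum_(i < n) tau_terms f s i.
  by rewrite seriesEnat /= big_mkord.
rewrite -sumrB.
apply: le_lt_trans (_ : e / 2 < e); last first.
  by rewrite ltr_pdivrMr// ltr_pMr// ltr1n.
apply: absv_sum_le => [|i _]; first exact: ltW.
rewrite /tau_terms -mulrBr -exprB_cardX absvM absvX.
by apply/ltW/Nb => //; apply/ltnW.
Qed.

End TauSeries.

(** * The exponential and the logarithm near [0] *)

Section DrinfeldExponential.
Context (R : realType) (F : finFieldType) (C : Cinfty R F) (r : nat).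
Context (E : drinfeldModule C r) (e l : nat -> C).
Context (He : is_exp E e) (Hl : is_log e l).
Local Notation q := #|F|.
Local Notation ex := (tau_eval e).
Local Notation lg := (tau_eval l).
Local Notation th := (theta C).
Implicit Types (x y z c w : C).

Lemma exp_entire : tau_entire e.
Proof. by case: He => _ ec _; apply: cvg_tau_entire. Qed.

Lemma exp_null x : null_seq (tau_terms e x).
Proof. exact/tau_entire_null/exp_entire. Qed.

Lemma expD x y : ex (x + y) = ex x + ex y.
Proof. by apply: tau_evalD; apply: exp_null. Qed.

Lemma expZ a x : ex (Fq_emb C a * x) = Fq_emb C a * ex x.
Proof. by apply: tau_evalZ; apply: exp_null. Qed.

Lemma expN x : ex (- x) = - ex x.
Proof. have ex0 : ex 0 = 0 by apply: (addrI (ex 0)); rewrite -expD !addr0.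
by apply/eqP; rewrite -addr_eq0 -expD addNr ex0. Qed.

Lemma expB x y : ex (x - y) = ex x - ex y.
Proof. by rewrite expD expN. Qed.

Definition phi_theta x : C := \sum_(i < r.+1) phi_t E i * x ^+ (q ^ i).

Lemma phi_t_eq0 i : (r.+1 <= i)%N -> phi_t E i = 0.
Proof. by rewrite /phi_t; case: i => // i; rewrite ltnNge => /negbTE ->. Qed.

Lemma tau_eval_phi_t x : tau_eval (phi_t E) x = phi_theta x.
Proof. exact: tau_eval_fin phi_t_eq0. Qed.

Lemma tau_const_eq0 c i : (1 <= i)%N -> tau_const c i = 0.
Proof. by case: i. Qed.

Lemma tau_eval_const c x : tau_eval (tau_const c) x = c * x.
Proof.
by rewrite (tau_eval_fin _ (@tau_const_eq0 c)) big_ord1 /tau_const expn0 expr1.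
Qed.

Lemma tau_null_const c x : null_seq (tau_terms (tau_const c) x).
Proof. exact/tau_entire_null/(tau_fin_entire (@tau_const_eq0 c)). Qed.

Lemma phi_X : phi E 'X = phi_t E.
Proof.
apply/funext => n; rewrite /phi size_polyX big_ord_recl big_ord1 !coefX /=.
rewrite rmorph0 rmorph1 mul0r add0r mul1r /tau_pow /= /tau_mul big_ord_recr /=.
rewrite subnn big1 => [|i _]; first by rewrite add0r /tau_const expr1n mulr1.
rewrite /tau_const (_ : (n - i)%N == 0%N = false) ?expr0_cardX ?mulr0//.
by apply/negbTE; rewrite subn_eq0 -ltnNge.
Qed.

Lemma exp_theta x : ex (th * x) = phi_theta (ex x).
Proof.
have [_ _ /(_ 'X)] := He.
rewrite phi_X /at_theta map_polyX hornerX => He'.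
rewrite -tau_eval_phi_t -tau_eval_comp ?tau_eval_const//; last 2 first.
- exact: tau_fin_entire phi_t_eq0.
- exact: exp_null.
rewrite -He' tau_eval_comp ?tau_eval_const//; first exact: exp_entire.
exact: tau_null_const.
Qed.

(** The outer series is entire, so convergence of [l] at [x] is enough to compose. *)
Lemma exp_log x : null_seq (tau_terms l x) -> ex (lg x) = x.
Proof.
have [_ el] := Hl => lx.
by rewrite -tau_eval_comp// ?el ?tau_eval_const ?mul1r//; apply: exp_entire.
Qed.

Lemma log_null x : ((absv x)%:E < tau_radius l)%E -> null_seq (tau_terms l x).
Proof.
move=> /ereal_sup_gt[_ [B [B0 lB] <-]]; rewrite lte_fin => xB d d0.
have [N Nl] := (absv_cvg0P _ _).1 lB d d0.
exists N => i /Nl; apply: le_lt_trans.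
rewrite absv_tau_terms ler_wpM2l ?absv_ge0// ger0_norm ?exprn_ge0//.
by rewrite lerXn2r// ?nnegrE ?absv_ge0// ltW.
Qed.

(** With [M] bounding the coefficients, take [rho = (1 + M)^-1]: for [i > 0] the exponent [q ^ i] is
    at least 2, and [M * rho <= 1]. In the disk of this radius [ex] is close to the identity. *)
Lemma exp_coef_bound :
  exists2 rho : R, 0 < rho & forall i, absv (e i) * rho ^+ (q ^ i) <= rho.
Proof.
have [M M0 eM] := null_seq_bounded (@exp_null 1).
have M1 : 0 < 1 + M by rewrite addr_gt0.
exists (1 + M)^-1 => [|[|i]]; first by rewrite invr_gt0.
  by rewrite expn0 expr1; have [-> _ _] := He; rewrite absv1 mul1r.
have /(_ i.+1) := eM; rewrite absv_tau_terms absv1 expr1n mulr1 => eiM.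
have rho0 : 0 <= (1 + M)^-1 by rewrite invr_ge0 ltW.
have rho1 : (1 + M)^-1 <= 1 by rewrite invf_le1// lerDl ltW.
apply: le_trans (_ : M * (1 + M)^-1 ^+ 2 <= _).
  by rewrite ler_pM ?absv_ge0 ?exprn_ge0// ler_wiXn2l// cardX_gt1.
rewrite expr2 mulrA ler_piMl// ler_pdivrMr// mul1r lerDr.
exact: ler01.
Qed.

Context (rho : R) (rho0 : 0 < rho).
Context (e_rho : forall i, absv (e i) * rho ^+ (q ^ i) <= rho).

(** Subtracting [z] leaves the terms with [i > 0]. Each is at most [rho (|z| / rho) ^ (q ^ i)],
    where [|z| / rho <= 1] and [q ^ i >= 2]. *)
Lemma exp_near_id z : absv z <= rho -> absv (ex z - z) <= absv z ^+ 2 / rho.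
Proof.
move=> zr; have [e0 _ _] := He.
have : (fun n => series (tau_terms e z) n.+1 - z) @ \oo --> ex z - z.
  have /cvg_absvP h := tau_eval_cvg (@exp_null z).
  apply/cvg_absvP => d /h [N Nh]; exists N => n Nn.
  by rewrite opprB addrA subrK; apply/Nh/leqW.
apply: cvg_valued_le => n.
rewrite seriesEnat /= big_nat_recl// {1}/tau_terms e0 mul1r expn0 expr1.
rewrite addrAC subrr add0r.
apply: absv_sum_le => [|i _]; first by rewrite divr_ge0 ?sqr_ge0 ?ltW.
rewrite absv_tau_terms.
have t0 : 0 <= absv z / rho by rewrite divr_ge0 ?absv_ge0 ?ltW.
have -> : absv z ^+ (q ^ i.+1) = rho ^+ (q ^ i.+1) * (absv z / rho) ^+ (q ^ i.+1).
  by rewrite -exprMn mulrCA divff ?mulr1// gt_eqF.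
have -> : absv z ^+ 2 / rho = rho * (absv z / rho) ^+ 2.
  by rewrite expr_div_n [rho ^+ 2]expr2 invfM mulrCA mulVKf// gt_eqF.
rewrite mulrA ler_pM ?mulr_ge0 ?absv_ge0 ?exprn_ge0// ?(ltW rho0)//.
by rewrite ler_wiXn2l ?cardX_gt1// ler_pdivrMr// mul1r.
Qed.

(** The difference [d] lies in the kernel, so [|d| <= |d| ^ 2 / rho], which is impossible for
    [0 < |d| < rho]. *)
Lemma exp_inj_small x y : absv x < rho -> absv y < rho -> ex x = ex y -> x = y.
Proof.
move=> xr yr /eqP; rewrite -subr_eq0 -expB => /eqP exy.
have dr : absv (x - y) < rho by rewrite (le_lt_trans (absvB _ _))// gt_max xr.
have := exp_near_id (ltW dr); rewrite exy sub0r absvN.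
apply: contraTeq; rewrite -subr_eq0 -absv_eq0 => d0.
have {}d0 : 0 < absv (x - y) by rewrite lt_def d0 absv_ge0.
by rewrite -ltNge ltr_pdivrMr// expr2 ltr_pM2l.
Qed.

(** For [n > 0], [l e = 1] gives [l n = - \sum_(i < n) l i * e (n - i) ^ (q ^ i)]. Since
    [q ^ n = q ^ (n - i) * q ^ i], the bound on [e (n - i)] reduces each term to the bound on
    [l i]. *)
Lemma log_coef_bound i : absv (l i) * rho ^+ (q ^ i) <= rho.
Proof.
have [le _] := Hl; have [e0 _ _] := He.
elim/ltn_ind: i => n IHn.
have /(congr1 (fun f => f n)) := le; rewrite /tau_mul big_ord_recr /= subnn e0.
rewrite expr1n mulr1 /tau_const; case: n IHn => [|n] IHn /=.
  by rewrite big_ord0 add0r => ->; rewrite absv1 mul1r expn0 expr1.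
move=> /eqP; rewrite addrC addr_eq0 => /eqP ->; rewrite absvN.
rewrite -[rho in rho ^+ _](ger0_norm (ltW rho0)) -ler_pdivlMr; last first.
  by rewrite exprn_gt0// normr_gt0 gt_eqF.
rewrite (ger0_norm (ltW rho0)).
apply: absv_sum_le => [|i _]; first by rewrite divr_ge0 ?exprn_ge0 ?(ltW rho0).
rewrite ler_pdivlMr ?exprn_gt0// absvM absvX.
have -> : rho ^+ (q ^ n.+1) = (rho ^+ (q ^ (n.+1 - i))) ^+ (q ^ i).
  by rewrite -exprM -expnD subnK// ltnW.
rewrite -mulrA -exprMn (le_trans _ (IHn i _))// ler_wpM2l ?absv_ge0//.
by rewrite lerXn2r// nnegrE ?mulr_ge0 ?absv_ge0 ?exprn_ge0 ?(ltW rho0).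
Qed.

Lemma log_terms_small x i : absv x <= rho ->
  absv (tau_terms l x i) <= rho * (absv x / rho) ^+ (q ^ i).
Proof.
move=> xr; have t0 : 0 <= absv x / rho by rewrite divr_ge0 ?absv_ge0 ?ltW.
rewrite absv_tau_terms.
have -> : absv x ^+ (q ^ i) = rho ^+ (q ^ i) * (absv x / rho) ^+ (q ^ i).
  by rewrite -exprMn mulrCA divff ?mulr1// gt_eqF.
by rewrite mulrA ler_wpM2r ?exprn_ge0// log_coef_bound.
Qed.

Lemma log_null_small x : absv x < rho -> null_seq (tau_terms l x).
Proof.
move=> xr d d0; have t0 : 0 <= absv x / rho by rewrite divr_ge0 ?absv_ge0 ?ltW.
have t1 : absv x / rho < 1 by rewrite ltr_pdivrMr// mul1r.
have /cvgrPdist_lt/(_ (d / rho) (divr_gt0 d0 rho0)) [N _ Ne] :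
    (absv x / rho) ^+ n @[n --> \oo] --> (0 : R).
  by apply: cvg_expr; rewrite ger0_norm.
exists N => n /Ne /=; rewrite sub0r normrN normrX ger0_norm// => xn.
apply: le_lt_trans (log_terms_small n (ltW xr)) _.
rewrite mulrC -ltr_pdivlMr//; apply: le_lt_trans xn.
by rewrite ler_wiXn2l ?(ltW t1)// ltnW// ltn_cardX.
Qed.

Lemma absv_log_le x : absv x < rho -> absv (lg x) <= absv x.
Proof.
move=> xr; apply: cvg_valued_le (tau_eval_cvg (log_null_small xr)) => n.
rewrite seriesEnat /=; apply: absv_sum_le => [|i _]; first exact: absv_ge0.
have t0 : 0 <= absv x / rho by rewrite divr_ge0 ?absv_ge0 ?ltW.
apply: le_trans (log_terms_small i (ltW xr)) _.
rewrite -[leRHS](@divfK _ rho) ?gt_eqF// mulrC ler_wpM2r ?(ltW rho0)//.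
rewrite -[leRHS]expr1 ler_wiXn2l ?cardX_gt0// ler_pdivrMr// mul1r.
exact: ltW.
Qed.

End DrinfeldExponential.

(** * Logarithms from null solutions of [t w = xi + phi_t(w)] *)

Section GeneratingFunction.
Context (R : realType) (F : finFieldType) (C : Cinfty R F) (r : nat).
Context (E : drinfeldModule C r) (e l : nat -> C).
Context (He : is_exp E e) (Hl : is_log e l).
Local Notation q := #|F|.
Local Notation ex := (tau_eval e).
Local Notation lg := (tau_eval l).
Local Notation th := (theta C).
Implicit Types (x y z c : C) (w : nat -> C).

(* A null solution of [t w = xi + phi_t(w)] is minus the Anderson generating
   function [\sum_n ex (y / th ^ n.+1) t^n] of a logarithm [y] of [xi]; the
   limit computes the residue of [w] at [t = th]. *)
Lemma generating_function w xi : null_seq w ->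
  (forall n, phi_theta E (w n.+1) = w n) -> phi_theta E (w 0%N) = - xi ->
  exists2 y, ex y = xi & (fun n => - (th ^+ n.+1 * w n)) @ \oo --> y.
Proof.
move=> hw wS w0; have [rho rho0 er] := exp_coef_bound He.
have q0 : 0 < absv th by rewrite absv_theta ltr0n cardF_gt0.
have q1 : 1 <= absv th by rewrite absv_theta ler1n cardF_gt0.
(* Below [rho / |theta|], multiplication by [theta] stays in the disk where [ex] is injective; hence
   [zS] for the logarithms [z n]. *)
have [N Nw] := hw _ (divr_gt0 rho0 q0).
pose z n := lg (w n).
have qrho : rho / absv th <= rho by rewrite ler_pdivrMr// ler_peMr// ltW.
have wr n : (N <= n)%N -> absv (w n) < rho.
  by move=> /Nw h; apply: lt_le_trans h qrho.
have zw n : (N <= n)%N -> absv (z n) <= absv (w n).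
  by move=> /wr h; apply: absv_log_le He Hl _ rho0 er _ h.
have zr n : (N <= n)%N -> absv (z n) < rho.
  by move=> Nn; apply: le_lt_trans (zw n Nn) (wr n Nn).
have ez n : (N <= n)%N -> ex (z n) = w n.
  by move=> /wr h; apply: exp_log He Hl _ (log_null_small He Hl rho0 er h).
have zS n : (N <= n)%N -> th * z n.+1 = z n.
  move=> Nn; have Nn1 := leqW Nn.
  apply: (exp_inj_small He rho0 er); last by rewrite (exp_theta He) !ez.
    rewrite absvM mulrC -ltr_pdivlMr//.
    by apply: le_lt_trans (zw _ Nn1) (Nw _ Nn1).
  exact: zr.
have zN k : th ^+ k * z (N + k)%N = z N.
  elim: k => [|k IHk]; first by rewrite expr0 mul1r addn0.
  by rewrite addnS exprSr -mulrA zS// leq_addr.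
(* For indices below [N], where [w] may be large, the functional equation descends from [w N]. *)
have eN k : (k <= N)%N -> ex (th ^+ k * z N) = w (N - k)%N.
  elim: k => [_|k IHk kN]; first by rewrite expr0 mul1r subn0 ez.
  by rewrite exprS -mulrA (exp_theta He) (IHk (ltnW kN)) -(wS (N - k.+1)%N) subnSK.
exists (- (th ^+ N.+1 * z N)).
  by rewrite (expN He) exprS -mulrA (exp_theta He) eN// subnn w0 opprK.
apply/cvg_absvP => d d0; set y := th ^+ N.+1 * z N.
have y1 : 0 < 1 + absv y by rewrite ltr_pwDl// absv_ge0.
(* The error is at most [|theta ^ n.+1| |z n| ^ 2 / rho = |y| |z n| / rho], and [|z n| <= |w n|].
   The summand 1 avoids a division by zero. *)
have [M Mw] := hw (d * rho / (1 + absv y)) ltac:(by rewrite divr_gt0 ?mulr_gt0).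
exists (maxn N M) => n; rewrite geq_max => /andP[Nn /Mw]; rewrite ltr_pdivlMr// => wd.
have -> : y = th ^+ n.+1 * z n.
  rewrite /y -(zN (n - N)%N) subnKC// mulrA -exprD; congr (_ ^+ _ * _).
  by rewrite addSn subnKC.
rewrite opprK addrC -mulrBr -(ez _ Nn) -absvN -mulrN opprB absvM.
have zn2 := exp_near_id He rho0 er (ltW (zr _ Nn)).
apply: le_lt_trans (_ : absv (th ^+ n.+1) * (absv (z n) ^+ 2 / rho) < d).
  by rewrite ler_wpM2l ?absv_ge0.
rewrite expr2 !mulrA ltr_pdivrMr//; apply: le_lt_trans wd.
rewrite mulrC ler_pM ?absv_ge0 ?mulr_ge0 ?absv_ge0 ?zw//.
suff -> : absv (th ^+ n.+1) * absv (z n) = absv y by rewrite lerDr.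
rewrite -absvM /y -(zN (n - N)%N) subnKC// mulrA -exprD.
by rewrite addSn subnKC.
Qed.

End GeneratingFunction.

(** * The Tate algebra and its Frobenius twist *)

Section Trivialization.
Context (R : realType) (F : finFieldType) (C : Cinfty R F).
Local Notation q := #|F|.
Local Notation th := (theta C).
Implicit Types (f g : fps C).

Lemma TateP f : Tate f <-> null_seq f.
Proof. by rewrite null_seqP. Qed.

Lemma TateM f g : Tate f -> Tate g -> Tate (f * g).
Proof. by rewrite !TateP; apply: convolution_null. Qed.

Lemma TateD f g : Tate f -> Tate g -> Tate (f + g).
Proof. by rewrite !TateP; apply: null_seqD. Qed.

Lemma Tate0 : Tate (0 : fps C).
Proof. by apply/TateP => e e0; exists 0%N => n _; rewrite absv0. Qed.

Lemma Tate_const c : Tate (fps_const c : fps C).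
Proof. by apply/TateP => e e0; exists 1%N => -[|n]//= _; rewrite absv0. Qed.

Lemma Tate_sum (I : Type) (s : seq I) (P : pred I) (f : I -> fps C) :
  (forall i, P i -> Tate (f i)) -> Tate (\sum_(i <- s | P i) f i).
Proof. by move=> fT; apply: big_ind => //; [exact: Tate0|exact: TateD]. Qed.

Lemma Tate_theta_Tate f : Tate_theta f -> Tate f.
Proof.
move=> /absv_cvg0P fT; apply/TateP => e /fT [N Nf]; exists N => n /Nf.
apply: le_lt_trans; rewrite ler_peMr ?absv_ge0// ger0_norm ?exprn_ge0//.
by rewrite exprn_ege1// ler1n cardF_gt0.
Qed.

Lemma Tate_mulmx m n p (A : 'M[fps C]_(m, n)) (B : 'M[fps C]_(n, p)) :
  entries_in (@Tate R F C) A -> entries_in (@Tate R F C) B ->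
  entries_in (@Tate R F C) (A *m B).
Proof.
by move=> AT BT i j; rewrite mxE; apply: Tate_sum => k _; apply: TateM.
Qed.

(** Named separately to carry the ring morphism structure, which lets the twist pass through matrix
    products and determinants. *)
Definition twist1 f : fps C := twist q 1 f.

Lemma twist1E f n : twist1 f n = f n ^+ q.
Proof. by rewrite /twist1 /= expn1. Qed.

Fact twist1_is_zmod_morphism : zmod_morphism twist1.
Proof.
move=> f g; apply: fpsP => n.
by rewrite -[RHS]/(twist1 f n - twist1 g n) !twist1E; apply: (exprB_cardX 1).
Qed.

Fact twist1_is_monoid_morphism : monoid_morphism twist1.
Proof.
split=> [|f g]; apply: fpsP => n; rewrite twist1E /=.
  by case: eqP => _; rewrite ?expr1n//; apply: (expr0_cardX C 1).
rewrite [LHS](expr_sum_cardX 1) expn1; apply: eq_bigr => i _.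
by rewrite exprMn.
Qed.

HB.instance Definition _ :=
  GRing.isZmodMorphism.Build (fps C) (fps C) twist1 twist1_is_zmod_morphism.
HB.instance Definition _ :=
  GRing.isMonoidMorphism.Build (fps C) (fps C) twist1 twist1_is_monoid_morphism.

Lemma twist1K f : twist1 (twist q (-1) f) = f.
Proof. by apply: fpsP => n; rewrite twist1E /= -[X in _ ^+ X]expn1 (frobNK 1). Qed.

Lemma vecL0_inhabited n (Z : 'rV[fps C]_n) :
  entries_in (@Tate R F C) Z -> exists v, vecL0 Z v.
Proof.
move=> ZT.
have /choice [f fP] j : exists f, Tate f /\ forall n, f n - f n ^+ q = Z 0 j n.
  have /TateP/artin_schreier_null [f f0 fZ] := ZT 0 j.
  by exists (Fps f); split=> //; apply/TateP.
exists (\row_j f j); split=> [i j|]; first by rewrite mxE; have [] := fP j.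
apply/rowP => j; rewrite !mxE; apply: fpsP => k; have [_ <-] := fP j.
by rewrite /= expn1.
Qed.

(** Meant for the entries of [Phi] and their twists, which have degree at most one in [t]. *)
Lemma fps_mul_affine f g n : (forall m, g m.+2 = 0) ->
  (f * g) n = f n * g 0%N + (if n is m.+1 then f m * g 1%N else 0).
Proof.
move=> g0; rewrite -[LHS]/(\sum_(i < n.+1) f i * g (n - i)%N).
rewrite big_ord_recr /= subnn addrC; congr (_ + _).
case: n => [|n]; first by rewrite big_ord0.
rewrite big_ord_recr /= subSnn big1 ?add0r// => i _.
by rewrite (subSn (ltnW (ltn_ord i))) -(subnSK (ltn_ord i)) g0 mulr0.
Qed.

(** * The twisted equation satisfied by [v Psi^-1] *)

Section Equations.
Context (r : nat) (E : drinfeldModule C r.+1).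
Local Notation kap := (kappa E).
Local Notation a := (fun j => frob q (- j%:Z) (kap j)).

Lemma root_kappa_neq0 : a r.+1 != 0.
Proof.
apply: contraNneq (kappa_rank_neq0 E) => a0.
by rewrite -(frobNK r.+1 (kap r.+1)) a0 expr0_cardX.
Qed.

(** Column [0] meets no superdiagonal entry, so only the last row, with its factor [t - theta],
    contributes. *)
Lemma twist1_Phi_0 f (i : 'I_r.+1) n :
  (f * twist1 (Phi E i 0)) n = if i == ord_max then
    f n * (- th / a r.+1) ^+ q +
      (if n is m.+1 then f m * (a r.+1)^-1 ^+ q else 0) else 0.
Proof.
have Z : (0 : C) ^+ q = 0 by apply: (expr0_cardX C 1).
rewrite fps_mul_affine => [|m]; last first.
  rewrite twist1E mxE /= eqSS; case: ifP => _.
    by rewrite coefZ coefB coefX coefC subr0 mulr0 Z.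
  by rewrite coef0 Z.
rewrite !twist1E mxE /= eqSS -val_eqE /=; case: ifP => _; last first.
  by rewrite !coef0 Z//; case: n => [|n]; rewrite !mulr0 addr0.
rewrite !coefZ !coefB !coefX !coefC /= sub0r subr0 mulr1.
by rewrite [- th / _]mulrC.
Qed.

Lemma twist1_Phi_S f (i j : 'I_r.+1) k n : j = k.+1 :> nat ->
  (f * twist1 (Phi E i j)) n = if i == ord_max then
    f n * (- a k.+1 / a r.+1) ^+ q else if i == k :> nat then f n else 0.
Proof.
move=> jk; have Z : (0 : C) ^+ q = 0 by apply: (expr0_cardX C 1).
have P0 m : twist1 (Phi E i j) m.+1 = 0.
  rewrite twist1E mxE /= eqSS jk /=; case: ifP => _; first by rewrite coefC Z.
  by case: (_ == _); rewrite ?coef1 ?coef0 Z.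
rewrite fps_mul_affine// P0.
have -> : (if n is m.+1 then f m * 0 else 0) = 0 :> C by case: n => // n; rewrite mulr0.
rewrite addr0 twist1E mxE /= eqSS -val_eqE /= jk /=; case: ifP => _.
  by rewrite coefC.
rewrite eqSS [k == _]eq_sym; case: eqP => _; first by rewrite coef1 expr1n mulr1.
by rewrite coef0 Z mulr0.
Qed.

(** Twisting the trivialization gives [Psi = Phi^(1) Psi^(1)]. Then [g^(1) Psi^(1) = v^(1) = v - xi
    e1 Psi = (g - xi e1) Phi^(1) Psi^(1)], and [Psi^(1)] cancels. *)
Lemma trivialization_eq (Psi : 'M[fps C]_r.+1) xi v :
  is_rigid_trivialization E Psi ->
  vecL0 (fps_const xi *: (e1 C r.+1 *m Psi)) v ->
  let g := v *m invmx Psi in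
  map_mx twist1 g = (g - fps_const xi *: e1 C r.+1) *m map_mx twist1 (Phi E).
Proof.
move=> [[uPsi _ _] _ PsiE] [_ vE] g.
have vg : v = g *m Psi by rewrite mulmxKV.
have PsiE1 : Psi = map_mx twist1 (Phi E) *m map_mx twist1 Psi.
  rewrite -map_mxM -PsiE; apply/matrixP => i j; rewrite !mxE.
  exact/esym/twist1K.
have uPsi1 : map_mx twist1 Psi \in unitmx.
  by rewrite unitmxE det_map_mx rmorph_unit// -unitmxE.
apply: (can_inj (mulmxK uPsi1)); rewrite -map_mxM -vg -mulmxA -PsiE1.
rewrite mulmxBl -vg -scalemxAl -vE opprB addrC subrK.
by apply/matrixP => i j; rewrite !mxE.
Qed.

Lemma trivialization_Tate (Psi : 'M[fps C]_r.+1) : is_rigid_trivialization E Psi ->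
  entries_in (@Tate R F C) Psi /\ entries_in (@Tate R F C) (invmx Psi).
Proof.
by move=> [[_ PT VT] _ _]; split=> i j; apply: Tate_theta_Tate; [apply: PT|apply: VT].
Qed.

End Equations.
End Trivialization.

(** * The exponential of the extended logarithm *)

Section ExtendedLogarithm.
Context (R : realType) (F : finFieldType) (C : Cinfty R F) (r : nat).
Context (E : drinfeldModule C r.+1) (e l : nat -> C).
Context (He : is_exp E e) (Hl : is_log e l).
Context (Psi : 'M[fps C]_r.+1) (HPsi : is_rigid_trivialization E Psi).
Local Notation q := #|F|.
Local Notation th := (theta C).
Local Notation kap := (kappa E).
Local Notation a := (fun j => frob q (- j%:Z) (kap j)).

(** Eliminates all entries but the first: unrolling [h k = (h k.+1 + a k.+1 * w) ^+ q] raises each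
    root [a k.+1] to the power [q ^ k.+1], which restores [kap k.+1]. *)
Lemma frobenius_chain (h g : nat -> C) w : h r = (a r.+1 * w) ^+ q ->
  (forall k, (k < r)%N -> h k.+1 = g k.+1) ->
  (forall k, (k < r)%N -> g k.+1 ^+ q = h k + (- a k.+1 * w) ^+ q) ->
  h 0%N = \sum_(k < r.+1) kap k.+1 * w ^+ (q ^ k.+1).
Proof.
(* The value [0] past [r] makes [hr] an instance of the same recurrence. *)
move=> hr hg gh; pose H k := if (k <= r)%N then h k else 0.
have HS k : (k <= r)%N -> H k = (H k.+1 + a k.+1 * w) ^+ q.
  move=> kr; rewrite /H kr; case: ltngtP kr => // [kr _|-> _]; last by rewrite add0r.
  rewrite hg// [RHS](exprD_cardX 1) expn1 gh//.
  by rewrite mulNr [in X in _ + X + _](exprN_cardX 1) expn1 subrK.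
have tele m : (m <= r.+1)%N ->
    h 0%N = H m ^+ (q ^ m) + \sum_(k < m) kap k.+1 * w ^+ (q ^ k.+1).
  elim: m => [|m IHm] mr; first by rewrite expn0 expr1 big_ord0 addr0.
  rewrite (IHm (ltnW mr)) (HS m mr) big_ord_recr /= [_ + kap _ * _]addrC addrA.
  congr (_ + _); rewrite -exprM -expnS exprD_cardX exprMn.
  by rewrite (frobNK m.+1 (kap m.+1)).
by rewrite (tele r.+1 (leqnn _)) /H ltnn expr0_cardX add0r.
Qed.

Lemma exp_vecL0 xi f : vecL0 (fps_const xi *: (e1 C r.+1 *m Psi)) f ->
  tau_eval e (fps_eval ((f *m invmx Psi *m (e1 C r.+1)^T) 0 0) th) = xi.
Proof.
move=> fL; have [fT _] := fL; have := trivialization_eq HPsi fL.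
have [_ VT] := trivialization_Tate HPsi.
have := Tate_mulmx fT VT; set g := f *m invmx Psi => gT /=.
set h := g - _ => gh.
have -> : (g *m (e1 C r.+1)^T) 0 0 = g 0 0.
  rewrite mxE big_ord_recl big1 ?addr0 => [|i _]; rewrite !mxE ?mulr0//.
  by rewrite mulr1.
have h0 n : h 0 0 n = g 0 0 n - xi *+ (n == 0%N).
  rewrite /h !mxE mulr1; congr (_ - _).
have hS (i : 'I_r.+1) : i != 0 -> h 0 i = g 0 i.
  move=> i0; rewrite /h !mxE -[i == 0%N :> nat]/(i == 0) (negbTE i0) mulr0 subr0//.
have hT i : Tate (h 0 i).
  have [->|i0] := eqVneq i 0; last by rewrite hS.
  apply/TateP; have := TateD (gT 0 0) (Tate_const (- xi)); rewrite TateP.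
  by apply: null_seq_le => n; rewrite h0 /= mulNrn.
have ar0 := root_kappa_neq0 E.
(* The series [w] is read off the last entry of [h], as its inverse twist divided by [a r.+1]. *)
have [v vh] := choice (fun n => cinfty_perfect 1 (h 0 ord_max n)).
pose w n := v n / a r.+1.
have arw n : h 0 ord_max n = (a r.+1 * w n) ^+ q.
  by rewrite -vh expn1 mulrCA divff// mulr1.
have ghE n j : g 0 j n ^+ q = \sum_i (h 0 i * twist1 (Phi E i j)) n.
  have /matrixP/(_ 0 j) := gh; rewrite !mxE => /(congr1 (fun u : fps C => u n)).
  rewrite twist1E => ->; rewrite (big_morph (fun u : fps C => u n) (id1 := 0) (op1 := +%R))//.
  by apply: eq_bigr => i _; rewrite [map_mx _ _ i j]mxE.
(* Column [0] of the equation says [g_1 = (t - theta) w] after one twist, and Frobenius is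
   injective. *)
have g0 n : g 0 0 n = (if n is m.+1 then w m else 0) - th * w n.
  apply: (@expr_cardX_inj R F C 1) => /=; rewrite expn1 ghE (bigD1 ord_max)// [X in _ + X = _]big1.
    rewrite addr0 twist1_Phi_0 eqxx arw addrC -exprMn.
    rewrite [RHS](exprB_cardX 1) expn1; congr (_ + _).
      case: n => [|n]; first by rewrite (expr0_cardX C 1).
      by rewrite arw -exprMn mulrAC divff// mul1r.
    rewrite mulrC mulrA mulfVK// mulNr.
    exact: (exprN_cardX 1).
  by move=> i ir; rewrite twist1_Phi_0 (negbTE ir).
have gS n k : (k < r)%N ->
    g 0 (inord k.+1) n ^+ q = h 0 (inord k) n + (- a k.+1 * w n) ^+ q.
  move=> kr; have kj : (inord k.+1 : 'I_r.+1) = k.+1 :> nat by rewrite inordK.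
  have kn : inord k != ord_max :> 'I_r.+1.
    by rewrite -val_eqE /= inordK ?ltn_eqF// ltnW.
  rewrite ghE (bigD1 ord_max)// (bigD1 (inord k))// [X in _ + (_ + X) = _]big1.
    rewrite !(twist1_Phi_S E _ _ _ kj) eqxx (negbTE kn) inordK ?eqxx; last exact: ltnW.
    rewrite addr0 addrC arw -exprMn mulrC mulrA mulfVK//.
  move=> i /andP[ir ik]; rewrite (twist1_Phi_S E _ _ _ kj) (negbTE ir).
  case: eqP => // ik'; move: ik; rewrite -val_eqE /= inordK ?ik' ?eqxx//.
  exact: ltnW.
(* The chain turns [h_1 = g_1 - xi] into the part of [phi_t(w)] of positive tau-degree; with
   [g_1 = (t - theta) w] the terms in [theta] cancel. *)
have phiw n : phi_theta E (w n) = (if n is m.+1 then w m else 0) - xi *+ (n == 0%N).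
  have i0 : inord 0 = 0 :> 'I_r.+1 by apply/val_inj; rewrite /= inordK.
  have ir : inord r = ord_max :> 'I_r.+1 by apply/val_inj; rewrite /= inordK.
  have := @frobenius_chain (fun k => h 0 (inord k) n) (fun k => g 0 (inord k) n) (w n).
  rewrite i0 ir => /(_ (arw n) _ (gS n)) hw.
  rewrite /phi_theta big_ord_recl /= expn0 expr1.
  rewrite (eq_bigr (fun k : 'I_r.+1 => kap k.+1 * w n ^+ (q ^ k.+1))) => [|i _].
    rewrite -hw => [|k kr]; first by rewrite h0 g0 addrA [X in X - _]addrC subrK.
    by rewrite hS// -val_eqE /= inordK.
  by rewrite /phi_t /= /bump /= add1n ltn_ord.
have wN : null_seq w.
  move=> d d0.
  have a0 : 0 < absv (a r.+1) by rewrite lt_def absv_ge0 absv_eq0 ar0.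
  have /TateP/(_ ((absv (a r.+1) * d) ^+ q)) := hT ord_max.
  rewrite exprn_gt0 ?mulr_gt0// => /(_ isT) [N Nh]; exists N => n /Nh.
  rewrite arw absvX absvM ltr_pXn2r ?nnegrE ?mulr_ge0 ?absv_ge0 ?ltW// ?cardF_gt0//.
  by rewrite ltr_pM2l.
have [||y exy wy] := generating_function He Hl (xi := xi) wN.
- by move=> n; rewrite phiw /= subr0.
- by rewrite phiw /= sub0r.
suff gy : series (fun i => g 0 0 i * th ^+ i) @ \oo --> y.
  by rewrite /fps_eval (lim_valued gy).
(* At [t = theta] the factor [t - theta] makes the sum telescope to its boundary term. *)
have part n : series (fun i => g 0 0 i * th ^+ i) n.+1 = - (th ^+ n.+1 * w n).
  elim: n => [|n IHn]; rewrite seriesEnat /= big_nat_recr//=.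
    by rewrite big_geq// add0r g0 sub0r mulr1 expr1.
  move: IHn; rewrite seriesEnat /= => ->; rewrite g0 mulrBl [w n * _]mulrC addKr.
  by rewrite mulrAC -exprS.
move/cvg_absvP: wy => wy; apply/cvg_absvP => d /wy [N Nw].
by exists N.+1 => -[//|n] Nn; rewrite part; apply: Nw.
Qed.

End ExtendedLogarithm.

(** * Extension of a partial linear section *)

Section LinearSection.
Context (R : realType) (F : finFieldType) (C : Cinfty R F).
Local Notation emb := (Fq_emb C).
Implicit Types (x y : C) (A B : set (C * C)).

(** Zorn's lemma for graphs of partial [F_q]-linear sections of [h] extending [s] on [D];
    surjectivity of [h] lets a maximal one be enlarged unless it is defined everywhere. *)
Lemma linear_section (h s : C -> C) (D : set C) :
  (forall x y, h (x + y) = h x + h y) ->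
  (forall a x, h (emb a * x) = emb a * h x) ->
  (forall x, exists y, h y = x) ->
  D 0 -> (forall x y, D x -> D y -> D (x + y)) -> (forall a x, D x -> D (emb a * x)) ->
  (forall x y, D x -> D y -> s (x + y) = s x + s y) ->
  (forall a x, D x -> s (emb a * x) = emb a * s x) ->
  (forall x, D x -> h (s x) = x) ->
  exists L : C -> C, [/\ forall x y, L (x + y) = L x + L y,
    forall a x, L (emb a * x) = emb a * L x, forall x, h (L x) = x
    & forall x, D x -> L x = s x].
Proof.
move=> hD hZ hsurj D0 DD DZ sD sZ hs.
(* The last clause encodes single-valuedness, which by linearity is a condition over [0]. *)
pose good A := [/\ forall x y x' y', A (x, y) -> A (x', y') -> A (x + x', y + y'),
  forall a x y, A (x, y) -> A (emb a * x, emb a * y),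
  forall x y, A (x, y) -> h y = x & forall y, A (0, y) -> y = 0].
pose G0 : set (C * C) := [set p | D p.1 /\ p.2 = s p.1].
have goodG0 : good G0.
  split=> [x y x' y' [/= Dx ->] [/= Dx' ->]|a x y [/= Dx ->]|x y [/= Dx ->]|y [/= _ ->]].
  - by split; [exact: DD|rewrite sD].
  - by split; [exact: DZ|rewrite sZ].
  - exact: hs.
  - by have := sZ 0 0 D0; rewrite rmorph0 !mul0r.
(* Adjoining [G0] to every set forces the graph to extend [s] and also settles the empty chain. *)
have [|A [goodA maxA]] := @Zorn_bigcup _ [set A | good (A `|` G0)].
  move=> T Tgood Ttot /=; set U := _ `|` G0.
  have G0U : G0 `<=` U by right.
  have XU X : T X -> X `|` G0 `<=` U.
    by move=> TX p [Xp|Gp]; [left; exists X|right].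
  have one p : U p -> exists Y, [/\ good Y, Y `<=` U & Y p].
    move=> [[X TX Xp]|Gp]; last by exists G0.
    by exists (X `|` G0); split; [exact: Tgood|exact: XU|left].
  have two p p' : U p -> U p' -> exists Y, [/\ good Y, Y `<=` U, Y p & Y p'].
    move=> [[X TX Xp]|Gp] [[X' TX' Xp']|Gp']; last by exists G0.
    - have [XX'|X'X] := Ttot _ _ TX TX'.
        exists (X' `|` G0); split; [exact: Tgood|exact: XU|left; exact: XX'|by left].
      by exists (X `|` G0); split; [exact: Tgood|exact: XU|left|left; exact: X'X].
    - by exists (X `|` G0); split; [exact: Tgood|exact: XU|left|right].
    - by exists (X' `|` G0); split; [exact: Tgood|exact: XU|right|left].
  split=> [x y x' y' /two h1 /h1 [Y [[YD _ _ _] YU Yp Yp']]|a x y /one [Y [[_ YZ _ _] YU Yp]]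
          |x y /one [Y [[_ _ Yh _] YU Yp]]|y /one [Y [[_ _ _ Y0] YU Yp]]].
  - by apply/YU/YD.
  - by apply/YU/YZ.
  - exact: Yh.
  - exact: Y0.
set G := A `|` G0 in goodA; have [GD GZ Gh Gv] := goodA.
have GN x y : G (x, y) -> G (- x, - y).
  by move=> /(GZ (-1)); rewrite rmorphN1 !mulN1r.
have Gfun x y y' : G (x, y) -> G (x, y') -> y = y'.
  move=> Gy /GN Gy'; apply/eqP; rewrite -subr_eq0; apply/eqP/Gv.
  by rewrite -(subrr x); apply: GD.
have G00 : G (0, 0).
  by right; split=> //=; have := sZ 0 0 D0; rewrite rmorph0 !mul0r.
have Gtot x0 : exists y, G (x0, y).
  apply: contrapT => nG; have [y0 hy0] := hsurj x0.
  (* The sum of [G] and the line spanned by [(x0, y0)]. *)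
  pose B : set (C * C) :=
    [set p | exists a : F, G (p.1 - emb a * x0, p.2 - emb a * y0)].
  have GB : G `<=` B.
    by move=> [x y] Gxy; exists 0; rewrite rmorph0 !mul0r !subr0.
  have B0 : B (x0, y0) by exists 1; rewrite rmorph1 !mul1r !subrr.
  apply: (maxA B).
    split=> [p Ap|BA]; first by apply: GB; left.
    by apply: nG; exists y0; left; apply: BA.
  rewrite /= setUidl; last by move=> p Gp; apply: GB; right.
  split.
  - move=> x y x' y' [a /= Ga] [b /= Gb]; exists (a + b) => /=.
    rewrite rmorphD !mulrDl !opprD [X in G (X, _)]addrACA [X in G (_, X)]addrACA.
    exact: GD.
  - move=> c x y [a /= Ga]; exists (c * a) => /=.
    by rewrite rmorphM -!mulrA -!mulrBr; apply: GZ.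
  - move=> x y [a /= /Gh ha].
    rewrite -(subrK (emb a * y0) y) hD hZ hy0 ha subrK//.
  - move=> y [a /= Ga].
    have [a0|a0] := eqVneq a 0.
      by move: Ga; rewrite a0 rmorph0 !mul0r !subr0 => /Gv.
    (* A nonzero multiple of [x0] in the domain of [G] would put [x0] itself there. *)
    exfalso; apply: nG; exists (emb (- a^-1) * (y - emb a * y0)).
    have := GZ (- a^-1) _ _ Ga; rewrite sub0r rmorphN mulrNN mulrA -rmorphM.
    by rewrite mulVf// rmorph1 mul1r.
have [L GL] := choice Gtot; exists L; split=> [x y|a x|x|x Dx].
- exact: Gfun (GL _) (GD _ _ _ _ (GL x) (GL y)).
- exact: Gfun (GL _) (GZ a _ _ (GL x)).
- exact: Gh (GL x).
- by apply: Gfun (GL x) _; right.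
Qed.

End LinearSection.

(** * Power series form of tau-series, and the fibres of the exponential *)

Section Branches.
Context (R : realType) (F : finFieldType) (C : Cinfty R F).
Local Notation q := #|F|.

(* The coefficient of [X ^ n] in [\sum_i f i X ^ (q ^ i)]; the bound [i < n]
   loses nothing since [i < q ^ i]. *)
Definition lacunary (f : nat -> C) (n : nat) : C :=
  \sum_(i < n) f i *+ (n == q ^ i)%N.

(** [up_log q N] is the number of [i] with [q ^ i < N]; it grows exactly when [N] passes a power of
    [q]. *)
Lemma series_lacunary f (x : C) N :
  series (fun n => lacunary f n * x ^+ n) N = series (tau_terms f x) (up_log q N).
Proof.
have q1 := cardF_gt1 F.
have serS h m : series h m.+1 = series h m + h m :> C.
  by rewrite seriesEnat /= big_nat_recr.
elim: N => [|N IHN]; first by rewrite up_log0 !seriesEnat /= !big_geq.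
rewrite serS IHN.
have [[k Nk]|nk] := pselect (exists k, N = (q ^ k)%N).
  rewrite Nk up_expnK//.
  have -> : up_log q (q ^ k).+1 = k.+1.
    by apply: up_log_eq => //; apply/andP; split=> //; rewrite ltn_exp2l.
  rewrite serS; congr (_ + _); rewrite /lacunary /tau_terms; congr (_ * _).
  rewrite (bigD1 (Ordinal (ltn_cardX F k)))//= eqxx big1 ?addr0// => i ik.
  rewrite eqn_exp2l//; case: eqP => // ki; case/eqP: ik.
  exact/val_inj/esym.
have -> : up_log q N.+1 = up_log q N.
  apply/eqP; rewrite eqn_leq [X in _ && X]leq_up_log// andbT.
  apply: up_log_min => //; rewrite ltn_neqAle up_logP// andbT.
  by apply/eqP => Nq; apply: nk; exists (up_log q N).
rewrite /lacunary big1 ?mul0r ?addr0// => i _.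
by case: eqP => // Ni; case: nk; exists i.
Qed.

Lemma cvg_lacunary f (x : C) : null_seq (tau_terms f x) ->
  series (fun n => lacunary f n * x ^+ n) @ \oo --> tau_eval f x.
Proof.
move=> /tau_eval_cvg/cvg_absvP fx; apply/cvg_absvP => d /fx [N Nf].
exists (q ^ N)%N => n Nn; rewrite series_lacunary; apply: Nf.
by rewrite -[N](@up_expnK q) ?leq_up_log// cardF_gt1.
Qed.

Lemma cvg_series_monomial0 (c x : C) :
  series (fun n => c *+ (n == 0%N) * x ^+ n) @ \oo --> c.
Proof.
apply/cvg_absvP => d d0; exists 1%N => -[//|n] _.
rewrite seriesEnat /= big_nat_recl//= big1 => [|i _]; last by rewrite mul0r.
by rewrite mulr1 addr0 subrr absv0.
Qed.

Context (r : nat) (E : drinfeldModule C r.+1) (e l : nat -> C).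
Context (He : is_exp E e) (Hl : is_log e l).
Context (Psi : 'M[fps C]_r.+1) (HPsi : is_rigid_trivialization E Psi).
Local Notation Lambda := (period_lattice e).

Lemma vecL0_e1_inhabited xi : exists f, vecL0 (fps_const xi *: (e1 C r.+1 *m Psi)) f.
Proof.
have [PT _] := trivialization_Tate HPsi.
apply: vecL0_inhabited => i j; rewrite mxE; apply: TateM; first exact: Tate_const.
apply: Tate_mulmx => // i' j'; rewrite mxE.
by case: eqP => _; [exact: (Tate_const 1)|exact: Tate0].
Qed.

(** The trivialization supplies a preimage: any representative of the extended logarithm of [x]. *)
Lemma exp_surj x : exists y, tau_eval e y = x.
Proof.
by have [f /(exp_vecL0 He Hl HPsi) fx] := vecL0_e1_inhabited x; eexists; apply: fx.
Qed.

(** Both sides are the fibre of the exponential over [x], since every representative produced by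
    [vecL0] has exponential [x]. *)
Lemma vec_logE x y : tau_eval e y = x -> vec_log Lambda Psi x = mod_coset Lambda y.
Proof.
move=> exy; apply/seteqP; split=> [z [f fL]|z].
  have fx := exp_vecL0 He Hl HPsi fL.
  by rewrite /mod_coset /period_lattice /= !(expB He) fx exy.
have [f fL] := vecL0_e1_inhabited x; have fx := exp_vecL0 He Hl HPsi fL.
rewrite /mod_coset /period_lattice /= (expB He) exy => zx.
by exists f => //; rewrite /mod_coset /period_lattice /= (expB He) fx.
Qed.

End Branches.

Theorem theorem3p8 (R : realType) (F : finFieldType) (C : Cinfty R F)
    (r : nat) (E : drinfeldModule C r)
    (expE logE : nat -> C) (hexp : is_exp E expE) (hlog : is_log expE logE)
    (Psi : 'M[fps C]_r) (hPsi : is_rigid_trivialization E Psi) (xi : C) :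
  (((absv xi)%:E < tau_radius logE)%E ->
     vec_log (period_lattice expE) Psi xi
     = mod_coset (period_lattice expE) (tau_eval logE xi)) /\
  (exists (rho : R) (L : C -> C) (c : nat -> C),
     [/\ 0 < rho,
         is_branch (period_lattice expE) Psi L &
         forall x : C, absv (x - xi) <= rho ->
           series (fun n => c n * (x - xi) ^+ n) @ \oo --> L x]).
Proof.
case: r => [|r] in E hexp Psi hPsi *; first by have := rank_gt0 E.
split=> [/log_null xiR|]; first exact/(vec_logE hexp hlog hPsi)/(exp_log hexp hlog).
have [rho rho0 erho] := exp_coef_bound hexp.
have lnull x : absv x < rho -> null_seq (tau_terms logE x).
  exact: log_null_small hexp hlog _ rho0 erho x.
(* The open disk of radius [rho] is an [F_q]-subspace by the ultrametric inequality, and the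
   logarithm is a linear section of the exponential on it. *)
have [||||x y xr yr|a x xr|x y xr yr|a x xr|x xr|L [LD LZ eL Llog]] :=
  @linear_section R F C (tau_eval expE) (tau_eval logE) [set x | absv x < rho].
- exact: expD hexp.
- exact: expZ hexp.
- exact: exp_surj hexp hlog _ hPsi.
- by rewrite /= absv0.
- by rewrite /= (le_lt_trans (absvD _ _))// gt_max xr.
- rewrite /= absvM; apply: le_lt_trans xr.
  by rewrite ler_piMl ?absv_ge0// absv_Fq_le1.
- by apply: tau_evalD; apply: lnull.
- by apply: tau_evalZ; apply: lnull.
- by apply: (exp_log hexp hlog); apply: lnull.
(* The closed disk of radius [rho / 2] lies in the open one of radius [rho], and there
   [L x = L xi + log (x - xi)] by additivity. *)
exists (rho / 2), L, (fun n => L xi *+ (n == 0%N) + lacunary logE n).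
split=> [|//|x xr]; first by rewrite divr_gt0.
  by split=> // x; apply: (vec_logE hexp hlog hPsi).
have {}xr : absv (x - xi) < rho.
  by apply: le_lt_trans xr _; rewrite ltr_pdivrMr// ltr_pMr// ltr1n.
have -> : L x = L xi + tau_eval logE (x - xi) by rewrite -Llog// -LD addrC subrK.
have := cvgD_valued (@cvg_series_monomial0 _ _ C (L xi) (x - xi)) (cvg_lacunary (lnull _ xr)).
suff -> : (fun n => series (fun n => L xi *+ (n == 0%N) * (x - xi) ^+ n) n +
    series (fun n => lacunary logE n * (x - xi) ^+ n) n) =
  series (fun n => (L xi *+ (n == 0%N) + lacunary logE n) * (x - xi) ^+ n) by [].
apply/funext => n; rewrite !seriesEnat /= -big_split; apply: eq_bigr => i _.
by rewrite mulrDl.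
Qed.
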